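(* Let $(\Xi,d)$, $c$, $\mathcal F$ satisfy the general assumptions (1)–(3) of the context, let $P$ be a probability distribution on $\Xi$, and assume $\rho_{\mathrm{crit}}>0$. Let $\lambda_{\mathrm{low}}>0$ be such that $\rho_{\max}(\lambda)\ge\frac{\rho_{\mathrm{crit}}}{4}$ for all $\lambda\in[0,2\lambda_{\mathrm{low}}]$, let $\delta\in(0,1)$, and set $$\alpha = 48\Big(\|\mathcal F\|_\infty+\frac1{\lambda_{\mathrm{low}}}\Big)\Big(\mathcal I_{\mathcal F}+\frac{2}{\lambda_{\mathrm{low}}}\Big)+\frac{2\|\mathcal F\|_\infty}{\lambda_{\mathrm{low}}}\sqrt{2\log\frac2\delta}.$$ If $n>\frac{16\alpha^2}{\rho_{\mathrm{crit}}^2}$ and $0<\rho\le\frac{\rho_{\mathrm{crit}}}{4}-\frac{\alpha}{\sqrt n}$, then with probability at least $1-\delta$, $$\widehat R_\rho(f)\le R_{\rho+\frac{\alpha}{\sqrt n}}(f)\qquad\text{for all } f\in\mathcal F.$$ In particular, if $c=d(\cdot,\cdot)^p$ with $p\in[1,\infty)$ and every $f\in\mathcal F$ is $\mathrm{Lip}_{\mathcal F}$-Lipschitz with respect to $d$, then (with probability at least $1-\delta$, for all $f\in\mathcal F$) $$\widehat R_\rho(f)\le\mathbb E_{\xi\sim P}[f(\xi)]+\mathrm{Lip}_{\mathcal F}\Big(\rho+\frac{\alpha}{\sqrt n}\Big)^{1/p}.$$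
   Context: $(\Xi,d)$ is a metric space, $\mathcal F$ is a family of functions $f:\Xi\to\mathbb R$, $c:\Xi\times\Xi\to\mathbb R$ is a cost function. General assumptions: (1) $(\Xi,d)$ is compact. (2) $c$ is jointly continuous with respect to $d$, non-negative, and $c(\xi,\zeta)=0$ if and only if $\xi=\zeta$. (3) Every $f\in\mathcal F$ is continuous, $(\mathcal F,\|\cdot\|_\infty)$ is compact, and Dudley's entropy $\mathcal I_{\mathcal F}:=\int_0^\infty\sqrt{\log N(t,\mathcal F,\|\cdot\|_\infty)}\,dt$ is finite, where $N(t,\mathcal F,\|\cdot\|_\infty)$ is the $t$-packing number of $\mathcal F$ (maximal number of functions in $\mathcal F$ that are pairwise at distance at least $t$). Notation: $\|f\|_\infty=\sup_{\Xi}|f|$ and $\|\mathcal F\|_\infty=\sup_{f\in\mathcal F}\|f\|_\infty$. $\mathcal P(\Xi)$ is the set of (Borel) probability measures on $\Xi$; for $\pi\in\mathcal P(\Xi\times\Xi)$, $[\pi]_1,[\pi]_2$ are its marginals. $W_c(Q,Q')=\inf\{\mathbb E_{(\xi,\zeta)\sim\pi}[c(\xi,\zeta)]:\pi\in\mathcal P(\Xi\times\Xi),[\pi]_1=Q,[\pi]_2=Q'\}$. For $\rho>0$, $R_{\rho,Q}(f)=\sup\{\mathbb E_{\xi\sim Q'}[f(\xi)]: Q'\in\mathcal P(\Xi), W_c(Q,Q')\le\rho\}$. With $\xi_1,\dots,\xi_n$ i.i.d. from $P$ and $\widehat P_n=\frac1n\sum_{i=1}^n\delta_{\xi_i}$,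 set $\widehat R_\rho(f)=R_{\rho,\widehat P_n}(f)$ and $R_\rho(f)=R_{\rho,P}(f)$. Critical radius: $\rho_{\mathrm{crit}}=\inf_{f\in\mathcal F}\mathbb E_{\xi\sim P}[\min\{c(\xi,\zeta):\zeta\in\operatorname{arg\,max}_\Xi f\}]$. Dual generator: $\phi(\lambda,f,\xi)=\sup_{\zeta\in\Xi}\{f(\zeta)-\lambda c(\xi,\zeta)\}$ for $\lambda\ge0$. Maximal radius: $\rho_{\max}(\lambda)=\inf_{f\in\mathcal F}\mathbb E_{\xi\sim P}[-\partial_\lambda^+\phi(\lambda,f,\xi)]$, where $\partial^+_\lambda$ is the right-sided derivative in $\lambda$. A constant $\lambda_{\mathrm{low}}$ with the property required in the claim always exists under these assumptions. *)

(* Defs.v *)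
From HB Require Import structures.
From mathcomp Require Import all_boot all_order all_algebra.
From mathcomp Require Import all_classical all_reals all_analysis.
Set Implicit Arguments.
Unset Strict Implicit.
Unset Printing Implicit Defensive.
Import Order.TTheory GRing.Theory Num.Theory.
Import numFieldNormedType.Exports.
Local Open Scope classical_set_scope.
Local Open Scope ring_scope.

(* Nonempty metric spaces: the library's measurable types carry a
   distinguished point.  On a space bearing a probability measure this is no
   restriction. *)
#[short(type="pmetricType")]
HB.structure Definition PointedMetric (K : numDomainType) :=
  { M of Metric K M & Pointed M }.

Notation borel T := (g_sigma_algebraType (@open T)).

Section sup_norms.
Context {R : realType} {T : Type}.

Definition sup_norm (f : T -> R) : R := sup [set `|f x| | x in [set: T]].

Definition family_norm (F : set (T -> R)) : R := sup [set sup_norm f | f in F].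

Definition is_packing (F : set (T -> R)) (t : R) (m : nat)
    (s : 'I_m -> T -> R) :=
  (forall i, F (s i)) /\
  (forall i j, i != j -> t <= sup_norm (fun x => s i x - s j x)).

(* Extended-real valued, so that +oo stands for arbitrarily large packings. *)
Definition packing_number (F : set (T -> R)) (t : R) : \bar R :=
  ereal_sup [set (m%:R)%:E | m in
    [set m : nat | exists s : 'I_m -> T -> R, is_packing F t s]].

Definition dudley (F : set (T -> R)) : \bar R :=
  (\int[lebesgue_measure]_(t in `]0%R, +oo[) poweR (lne (packing_number F t)) 2^-1)%E.

End sup_norms.

Section wasserstein.
Context {R : realType} {Xi : pmetricType R}.
Variable c : Xi -> Xi -> R.

(* Library measures are functions on all subsets: marginals are compared on
   Borel sets only. *)
Definition is_coupling (Q Q' : {measure set (borel Xi) -> \bar R})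
    (pi : probability (borel (Xi * Xi)%type) R) :=
  forall A : set (borel Xi), measurable A ->
    pushforward pi (fst : borel (Xi * Xi)%type -> borel Xi) A = Q A /\
    pushforward pi (snd : borel (Xi * Xi)%type -> borel Xi) A = Q' A.

Definition transport_cost (Q Q' : {measure set (borel Xi) -> \bar R}) : \bar R :=
  ereal_inf [set ('E_pi[fun z => c z.1 z.2])%E | pi in
    [set pi : probability (borel (Xi * Xi)%type) R | is_coupling Q Q' pi]].

Definition robust_risk (rho : R) (Q : {measure set (borel Xi) -> \bar R})
    (f : Xi -> R) : \bar R :=
  ereal_sup [set ('E_Q'[f])%E | Q' in
    [set Q' : probability (borel Xi) R |
      (transport_cost Q Q' <= rho%:E)%E]].

Definition argmax (f : Xi -> R) : set Xi :=
  [set zeta | forall xi, f xi <= f zeta].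

Definition dual_generator (lambda : R) (f : Xi -> R) (xi : Xi) : R :=
  sup [set f zeta - lambda * c xi zeta | zeta in [set: Xi]].

Definition right_derivative (g : R -> R) (x : R) : R :=
  lim ((h^-1 * (g (x + h) - g x)) @[h --> 0^'+]).

Variable P : probability (borel Xi) R.
Variable F : set (Xi -> R).

Definition rho_crit : R :=
  inf [set fine ('E_P[fun xi => inf [set c xi zeta | zeta in argmax f]])%E
      | f in F].

Definition rho_max (lambda : R) : R :=
  inf [set fine ('E_P[fun xi =>
             (- right_derivative (fun l => dual_generator l f xi) lambda)%R])%E
      | f in F].

End wasserstein.

Section sampling.
Context {R : realType} {d1 d2 : measure_display}.
Context {Omega : measurableType d1} {T : measurableType d2}.
Variable Pr : probability Omega R.

Definition independent_rvs (n : nat) (X : 'I_n -> Omega -> T) :=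
  forall (J : {set 'I_n}) (A : 'I_n -> set T), (forall i, measurable (A i)) ->
    Pr [set w | forall i, i \in J -> A i (X i w)] =
    (\prod_(i in J) Pr (X i @^-1` A i))%E.

Definition iid_from (P : probability T R) (n : nat) (X : 'I_n -> Omega -> T) :=
  [/\ forall i, measurable_fun [set: Omega] (X i),
      forall i (A : set T), measurable A -> pushforward Pr (X i) A = P A
    & independent_rvs X].

(* The event [A] need not be assumed measurable: it is required to contain a
   measurable event of probability at least [a]. *)
Definition with_probability_at_least (a : R) (A : set Omega) :=
  exists E : set Omega, [/\ measurable E, (a%:E <= Pr E)%E & E `<=` A].

End sampling.

Section empirical_measure.
Context {R : realType} {d : measure_display} {T : measurableType d}.
Variables (n : nat) (x : 'I_n -> T).

Definition empirical (A : set T) : \bar R :=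
  ((n%:R^-1)%:E * \sum_(i < n) \d_(x i) A)%E.

Let empirical0 : empirical set0 = 0%E.
Proof. by rewrite /empirical big1 ?mule0// => i _; rewrite measure0. Qed.

Let empirical_ge0 A : (0 <= empirical A)%E.
Proof. by rewrite mule_ge0 ?lee_fin ?invr_ge0// sume_ge0. Qed.

Let empirical_sigma_additive : semi_sigma_additive empirical.
Proof.
pose m (k : nat) : {measure set T -> \bar R} :=
  if insub k is Some i then \d_(x i) else mzero.
have n0 : 0 <= n%:R^-1 :> R by rewrite invr_ge0.
have -> : empirical = mscale (NngNum n0) (msum m n).
  apply/funext => A; rewrite /empirical /mscale /msum /=; congr *%E.
  by apply: eq_bigr => i _; rewrite /m valK.
exact: measure_semi_sigma_additive.
Qed.

HB.instance Definition _ := isMeasure.Build _ _ _ empirical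
  empirical0 empirical_ge0 empirical_sigma_additive.

End empirical_measure.

(* Main.v *)
Require Import Defs.
From HB Require Import structures.
From mathcomp Require Import all_boot all_order all_algebra.
From mathcomp Require Import all_classical all_reals all_analysis.
From mathcomp Require Import measurable_realfun zify ring lra.
Import Order.TTheory GRing.Theory Num.Theory.
Import numFieldNormedType.Exports.
Local Open Scope classical_set_scope.
Local Open Scope ring_scope.
Set Implicit Arguments.
Unset Strict Implicit.
Unset Printing Implicit Defensive.

(* Write phi(l, f, x) = sup_z (f(z) - l c(x, z)). Weak duality bounds the
   empirical risk by l rho + E_{P_n} phi(l, f) for every l >= 0. Strong duality
   for P (a supporting line of the convex set of pairs (E_pi c, E_pi f)) gives
   some l >= 0 with l rho' + E_P phi(l, f) <= R_{rho'}(f), where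
   rho' = rho + alpha / sqrt n. If l < lambda_low, then l can be raised to
   lambda_low: phi is convex in l and rho' <= rho_crit / 4 <= rho_max(lambda_low),
   so the dual objective does not increase. It remains to bound
   (E_{P_n} - E_P) phi(l, f) by l alpha / sqrt n for all f and l >= lambda_low.
   With mu = 1 / l this is the deviation of g_{mu f} = sup_z (mu f(z) - c(., z)),
   which is 1-Lipschitz in mu f for the sup norm. Chaining, with Hoeffding's
   inequality and a union bound at each level, along maximal packings of F at
   scales |F| / 2^(k+1) times grids of [0, 1 / lambda_low] of mesh 4^-k, gives
   the bound directly with high probability; the links have total length
   2 |F| / lambda_low, whence the coefficient of sqrt (2 log (2 / delta)). *)

(** * Hoeffding's inequality *)

Lemma ge0_derive_nondecreasing (R : realType) (f f' : R -> R) :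
  (forall t, is_derive t (1 : R) f (f' t)) -> (forall t, 0 <= t -> 0 <= f' t) ->
  forall t, 0 <= t -> f 0 <= f t.
Proof.
move=> df f'0 t t0.
have [|z /[!in_itv]/= /andP[z0 _]] := @MVT_segment R f f' 0 t t0 (fun z _ => df z).
  apply: continuous_subspaceT => z.
  exact/differentiable_continuous/derivable1_diffP/(@ex_derive _ _ _ _ _ _ _ (df z)).
by rewrite subr0 -subr_ge0 => ->; rewrite mulr_ge0 ?f'0.
Qed.

(** The left side [S x] is the exponential moment at [x] of a variable with values in {-1, 1} and
    mean [u]. Its logarithmic derivative starts at [u] and grows at rate at most 1, so ln S(x) is at
    most u x + x^2 / 2. *)
Lemma hoeffding_cosh (R : realType) (u x : R) : -1 <= u <= 1 -> 0 <= x ->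
  (1 + u) / 2 * expR x + (1 - u) / 2 * expR (- x) <= expR (u * x + x ^+ 2 / 2).
Proof.
move=> /andP[u1 u2] x0.
pose S t : R := (1 + u) / 2 * expR t + (1 - u) / 2 * expR (- t).
pose S' t : R := (1 + u) / 2 * expR t - (1 - u) / 2 * expR (- t).
have S_gt0 t : 0 < S t.
  rewrite /S; have := expR_gt0 t; have := expR_gt0 (- t); nra.
have dS t : is_derive t (1 : R) S (S' t).
  rewrite /S /S'; apply: is_derive_eq.
  by rewrite /= ?scaler0 ?add0r ?addr0 /GRing.scale/=; ring.
have dS' t : is_derive t (1 : R) S' (S t).
  rewrite /S /S'; apply: is_derive_eq.
  by rewrite /= ?scaler0 ?add0r ?addr0 /GRing.scale/=; ring.
(* [(S'/S)' = 1 - (S'/S)^2 <= 1] and [S'(0)/S(0) = u] *)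
have S'_le t : 0 <= t -> S' t <= (u + t) * S t.
  move=> t0; rewrite -ler_pdivrMr// -subr_ge0.
  have dinv z : is_derive z (1 : R) (fun z => (S z)^-1) (- (S z) ^- 2 * S' z).
    by apply: is_derive_eq; [apply: is_deriveV; rewrite gt_eqF|].
  have := @ge0_derive_nondecreasing R (fun z => u + z - S' z / S z)
     (fun z => (S' z / S z) ^+ 2) _ _ t t0.
  have -> : u + 0 - S' 0 / S 0 = 0.
    have S0 : S 0 = 1 by rewrite /S oppr0 expR0; field.
    have S'0 : S' 0 = u by rewrite /S' oppr0 expR0; field.
    by rewrite S0 S'0 addr0 divr1 subrr.
  apply=> [z|z _]; last exact: sqr_ge0.
  have Sn0 : S z != 0 by rewrite gt_eqF.
  by apply: is_derive_eq; rewrite /GRing.scale/=; field.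
(* [H] is minus the ratio of the two sides, and the bound on [S'] makes its derivative nonnegative
   for [z >= 0]. *)
pose H z : R := - (expR (- (u * z + z ^+ 2 / 2)) * S z).
have : H 0 <= H x.
  apply: (@ge0_derive_nondecreasing R H
    (fun z => expR (- (u * z + z ^+ 2 / 2)) * ((u + z) * S z - S' z))) => // [z|z z0].
    rewrite /H; apply: is_derive_eq.
    by rewrite /= ?scaler0 ?add0r ?addr0 /GRing.scale/=; field.
  by rewrite mulr_ge0 ?expR_ge0// subr_ge0 S'_le.
have -> : H 0 = - 1.
  by rewrite /H /S (_ : u * 0 + 0 ^+ 2 / 2 = 0) ?oppr0 ?expR0; [lra|ring].
by rewrite /H lerN2 expRN mulrC ler_pdivrMr ?expR_gt0// mul1r.
Qed.

(** * Bounded random variables and their means *)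

Section bounded_rv.
Context {R : realType} {d : measure_display} {T : measurableType d}.

(** Boundedness everywhere makes such a function integrable for every probability, so [mean] is
    linear and monotone on this class with no further integrability conditions. *)
Definition bounded_rv (g : T -> R) :=
  measurable_fun [set: T] g /\ exists M, forall x, `|g x| <= M.

Lemma bounded_rv_cst r : bounded_rv (cst r).
Proof. by split; [exact: measurable_cst|exists `|r|]. Qed.

Lemma bounded_rvD f g : bounded_rv f -> bounded_rv g ->
  bounded_rv (fun x => f x + g x).
Proof.
move=> [mf [a fa]] [mg [b gb]]; split; first exact: measurable_funD.
by exists (a + b) => x; rewrite (le_trans (ler_normD _ _))// lerD.
Qed.

Lemma bounded_rvZ r f : bounded_rv f -> bounded_rv (fun x => r * f x).
Proof.
move=> [mf [a fa]]; split; first exact: measurable_funM.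
by exists (`|r| * a) => x; rewrite normrM ler_wpM2l.
Qed.

Lemma bounded_rvB f g : bounded_rv f -> bounded_rv g ->
  bounded_rv (fun x => f x - g x).
Proof.
move=> [mf [a fa]] [mg [b gb]]; split; first exact: measurable_funB.
by exists (a + b) => x; rewrite (le_trans (ler_normB _ _))// lerD.
Qed.

Lemma bounded_rv_integrable (P : {measure set T -> \bar R}) g :
  (P setT < +oo)%E -> bounded_rv g -> P.-integrable setT (EFin \o g).
Proof.
move=> Pfin [mg [M gM]]; apply: measurable_bounded_integrable => //.
exists M; split; first exact: num_real.
by move=> y My x _; apply: le_trans (gM x) _; exact: ltW.
Qed.

Variable P : probability T R.

Definition mean (g : T -> R) : R := (\int[P]_x g x)%R.

Lemma bounded_rv_Pintegrable g : bounded_rv g -> P.-integrable setT (EFin \o g).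
Proof.
by move=> bg; apply: bounded_rv_integrable bg; rewrite ltey_eq fin_num_measure.
Qed.

Lemma meanE g : bounded_rv g -> (\int[P]_x (g x)%:E)%E = (mean g)%:E.
Proof.
move=> bg; rewrite /mean /Rintegral fineK//.
exact/integrable_fin_num/bounded_rv_Pintegrable.
Qed.

Lemma expectation_mean g : bounded_rv g -> 'E_P[g]%E = (mean g)%:E.
Proof. by move=> bg; rewrite unlock meanE. Qed.

Lemma mean_cst r : mean (cst r) = r.
Proof. by rewrite /mean Rintegral_cst//= [P _]probability_setT mulr1. Qed.

Lemma meanD f g : bounded_rv f -> bounded_rv g ->
  mean (fun x => f x + g x) = mean f + mean g.
Proof. by move=> bf bg; apply: RintegralD => //; exact: bounded_rv_Pintegrable. Qed.

Lemma meanB f g : bounded_rv f -> bounded_rv g ->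
  mean (fun x => f x - g x) = mean f - mean g.
Proof. by move=> bf bg; apply: RintegralB => //; exact: bounded_rv_Pintegrable. Qed.

Lemma meanZ r g : bounded_rv g -> mean (fun x => r * g x) = r * mean g.
Proof. by move=> bg; apply: RintegralZl => //; exact: bounded_rv_Pintegrable. Qed.

Lemma mean_le f g : bounded_rv f -> bounded_rv g -> (forall x, f x <= g x) ->
  mean f <= mean g.
Proof. by move=> bf bg fg; apply: le_Rintegral => //; exact: bounded_rv_Pintegrable. Qed.

Lemma mean_ge0 g : (forall x, 0 <= g x) -> 0 <= mean g.
Proof. by move=> g0; apply: Rintegral_ge0. Qed.

Lemma mean_norm_le g M : bounded_rv g -> (forall x, `|g x| <= M) -> `|mean g| <= M.
Proof.
move=> bg gM; rewrite ler_norml -{1}(mean_cst (- M)) -{2}(mean_cst M).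
rewrite !mean_le//; try exact: bounded_rv_cst.
all: by move=> x /=; have := gM x; rewrite ler_norml => /andP[].
Qed.

Lemma bounded_rv_sum (I : Type) (r : seq I) (g : I -> T -> R) :
  (forall i, bounded_rv (g i)) -> bounded_rv (fun x => \sum_(i <- r) g i x).
Proof.
move=> bg; elim: r => [|i r ih].
  by under eq_fun do rewrite big_nil; exact: bounded_rv_cst.
by under eq_fun do rewrite big_cons; exact: bounded_rvD.
Qed.

Lemma mean_sum (I : Type) (r : seq I) (g : I -> T -> R) :
  (forall i, bounded_rv (g i)) ->
  mean (fun x => \sum_(i <- r) g i x) = \sum_(i <- r) mean (g i).
Proof.
move=> bg; elim: r => [|i r ih].
  by under eq_fun do rewrite big_nil; rewrite big_nil mean_cst.
under eq_fun do rewrite big_cons.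
by rewrite big_cons meanD ?ih//; exact: bounded_rv_sum.
Qed.

Lemma bounded_rv_indic (A : set T) : measurable A -> bounded_rv (\1_A).
Proof.
move=> mA; split; first exact: measurable_indic.
by exists 1 => x; rewrite indicE; case: (_ \in _); rewrite ?normr1 ?normr0.
Qed.

Lemma mean_indic (A : set T) : measurable A -> mean (\1_A) = fine (P A).
Proof. by move=> mA; rewrite /mean /Rintegral integral_indic// setIT. Qed.

End bounded_rv.

Lemma bounded_rv_comp (R : realType) d1 d2 (T1 : measurableType d1)
    (T2 : measurableType d2) (X : T1 -> T2) (g : T2 -> R) :
  measurable_fun setT X -> bounded_rv g -> bounded_rv (g \o X).
Proof. by move=> mX [mg [M gM]]; split; [exact: measurableT_comp|exists M => x /=]. Qed.

Lemma mean_comp (R : realType) d1 d2 (T1 : measurableType d1)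
    (T2 : measurableType d2) (Pr : probability T1 R) (P : probability T2 R) (X : T1 -> T2) (g : T2 -> R) :
  measurable_fun setT X ->
  (forall A, measurable A -> pushforward Pr X A = P A) ->
  bounded_rv g -> mean P g = mean Pr (g \o X).
Proof.
move=> mX XP bg; apply/EFin_inj; rewrite -!meanE//; last exact: bounded_rv_comp.
have bgX := bounded_rv_comp mX bg.
transitivity (\int[pushforward Pr X]_y (g y)%:E)%E.
  by apply: eq_measure_integral => A mA _; exact/esym/XP.
apply: (@integral_pushforward _ _ _ _ _ X mX Pr setT (EFin \o g)) => //.
  by apply/measurable_EFinP; case: bg.
exact: bounded_rv_Pintegrable.
Qed.

(** Convexity of exp: its tangent at [x * y], evaluated at [x] and [- x] and averaged with weights
    (1 + y) / 2 and (1 - y) / 2, has no linear term left. *)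
Lemma expR_chord (R : realType) (x y : R) : -1 <= y <= 1 ->
  expR (x * y) <= (1 + y) / 2 * expR x + (1 - y) / 2 * expR (- x).
Proof.
move=> /andP[y1 y2].
have tangent a : expR (x * y) * (1 + (a - x * y)) <= expR a.
  have -> : expR a = expR (x * y) * expR (a - x * y).
    by rewrite -expRD addrC subrK.
  by rewrite ler_wpM2l ?expR_ge0 ?expR_ge1Dx.
have y1' : 0 <= (1 + y) / 2 by lra.
have y2' : 0 <= (1 - y) / 2 by lra.
have := lerD (ler_wpM2l y1' (tangent x)) (ler_wpM2l y2' (tangent (- x))).
by apply: le_trans; rewrite le_eqVlt; apply/orP; left; apply/eqP; field.
Qed.

Section step.
Context {R : realType} {d : measure_display} {T : measurableType d}.

(** Independence is stated for events. Step functions carry it over to products of functions. *)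
Lemma step_approximation (h : T -> R) (e : R) : 0 < e -> bounded_rv h ->
  (forall x, 0 <= h x) ->
  exists (m : nat) (v : 'I_m -> R) (A : 'I_m -> set T),
    (forall j, measurable (A j)) /\
    forall x, h x <= \sum_j v j * \1_(A j) x <= h x + e.
Proof.
move=> e0 [mh [C hC]] h0.
(* [m] levels of height [e] cover the range of [h]; each carries the value of its upper end, so the
   approximation is from above. *)
pose m := (Num.truncn (C / e)).+1.
exists m, (fun j => j.+1%:R * e),
  (fun j => h @^-1` [set` `[j%:R * e, j.+1%:R * e[]); split.
  by move=> j; rewrite -[X in measurable X]setTI; apply: mh => //; exact: measurable_itv.
move=> x.
have he0 : 0 <= h x / e by rewrite divr_ge0// ltW.
have /andP[] := truncn_itv he0; set k := Num.truncn _ => kh hk.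
have km : (k < m)%N.
  rewrite ltnS /k truncn_le_nat//.
  apply: le_lt_trans (truncnS_gt _); rewrite ler_pM2r ?invr_gt0//.
  by rewrite (le_trans (ler_norm _)).
rewrite (bigD1 (Ordinal km))//= big1 ?addr0.
  have -> : \1_(h @^-1` [set` `[k%:R * e, k.+1%:R * e[]) x = 1 :> R.
    rewrite indicE mem_set//= in_itv/=.
    by rewrite -ler_pdivlMr// kh -ltr_pdivrMr.
  rewrite mulr1 -ler_pdivrMr// ltW//=.
  by rewrite -natr1 mulrDl mul1r lerD2r -ler_pdivlMr.
move=> j /negP jk; rewrite indicE memNset ?mulr0//= in_itv/= => /andP[jh hj].
apply: jk; apply/eqP/val_inj => /=; apply/esym/truncn_def.
by rewrite ler_pdivlMr// jh ltr_pdivrMr.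
Qed.

End step.

Section iid.
Context {R : realType} {d1 d2 : measure_display}.
Context {Omega : measurableType d1} {T : measurableType d2}.
Variables (Pr : probability Omega R) (P : probability T R).
Variables (n : nat) (X : 'I_n -> Omega -> T).
Hypothesis X_iid : iid_from Pr P X.

Lemma bounded_rv_prod (I : Type) (r : seq I) (g : I -> Omega -> R) :
  (forall i, bounded_rv (g i)) -> bounded_rv (fun x => \prod_(i <- r) g i x).
Proof.
move=> bg; elim: r => [|i r [mp [b pb]]].
  by under eq_fun do rewrite big_nil; exact: bounded_rv_cst.
under eq_fun do rewrite big_cons.
have [mg [a ga]] := bg i; split; first exact: measurable_funM.
by exists (a * b) => x; rewrite normrM ler_pM.
Qed.

(** The product of sums expands over all maps [f] from samples to levels. Each term is a constant
    times the indicator of an intersection of independent events. *)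
Lemma iid_mean_prod_step (m : nat) (v : 'I_m -> R) (A : 'I_m -> set T) :
  (forall j, measurable (A j)) ->
  let h x := \sum_j v j * \1_(A j) x in
  mean Pr (fun w => \prod_(i < n) h (X i w)) = mean P h ^+ n.
Proof.
move=> mA h; have [mX XP indep] := X_iid.
have bA j : bounded_rv (\1_(A j) : T -> R) by exact: bounded_rv_indic.
have -> : mean P h = \sum_j v j * fine (P (A j)).
  rewrite mean_sum => [|j]; last exact: bounded_rvZ.
  by apply: eq_bigr => j _; rewrite meanZ ?mean_indic.
under [X in mean _ X]eq_fun do rewrite bigA_distr_bigA/=.
rewrite mean_sum => [|f]; last first.
  apply: bounded_rv_prod => i; apply: bounded_rvZ.
  exact: (bounded_rv_comp (mX i) (bA (f i))).
rewrite -[n in RHS]card_ord -prodr_const bigA_distr_bigA/=.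
apply: eq_bigr => f _; rewrite big_split/=.
under [X in mean _ X]eq_fun do rewrite big_split/=.
pose E := [set w | forall i, i \in [set: 'I_n]%SET -> A (f i) (X i w)].
have mE : measurable E.
  rewrite (_ : E = \bigcap_(i in [set: 'I_n]%classic) (X i @^-1` A (f i))).
    apply: fin_bigcap_measurable => [|i _]; first exact: finite_finset.
    by rewrite -[X in measurable X]setTI; apply: mX.
  by apply/seteqP; split => w Ew i => [_|_]; apply: Ew => //; rewrite inE.
have indE w : \prod_(i < n) \1_(A (f i)) (X i w) = \1_E w :> R.
  have [Ew|Ew] := pselect (E w).
    rewrite indicE mem_set// big1// => i _.
    by rewrite indicE mem_set//; apply: Ew.
  rewrite indicE memNset//.
  have [i Ai] : exists i, ~ A (f i) (X i w).
    by apply: contrapT => H; apply: Ew => i _; apply: contrapT => Ai; apply: H; exists i.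
  by rewrite (bigD1 i)//= indicE memNset ?mul0r.
have -> : (fun w => \prod_(i < n) v (f i) * \prod_(i < n) \1_(A (f i)) (X i w)) =
  (fun w => \prod_(i < n) v (f i) * \1_E w).
  by apply/funext => w; rewrite indE.
rewrite meanZ; last exact: bounded_rv_indic.
congr *%R; rewrite mean_indic// (indep _ (fun i => A (f i)))//.
rewrite (_ : (\prod_(i in [set: 'I_n]%SET) Pr (X i @^-1` A (f i)) =
    \prod_(i < n) Pr (X i @^-1` A (f i)))%E); last first.
  apply: eq_bigl => i. by rewrite finset.in_setT.
have -> : (\prod_(i < n) Pr (X i @^-1` A (f i)) = \prod_(i < n) P (A (f i)))%E.
  by apply: eq_bigr => i _; exact: XP.
apply: EFin_inj; rewrite fineK.
  rewrite (big_morph EFin (@EFinM R) erefl).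
  by apply: eq_bigr => i _; rewrite fineK// fin_num_measure.
by apply: prode_fin_num => i _; rewrite fin_num_measure.
Qed.

(** [h] lies below step functions that exceed it by at most [e]; the product formula applies to
    these, and [e] tends to 0. *)
Lemma iid_mean_prod_le (h : T -> R) : bounded_rv h -> (forall x, 0 <= h x) ->
  mean Pr (fun w => \prod_(i < n) h (X i w)) <= mean P h ^+ n.
Proof.
move=> bh h0; have [mX XP indep] := X_iid.
have he e : 0 < e ->
    mean Pr (fun w => \prod_(i < n) h (X i w)) <= (mean P h + e) ^+ n.
  move=> e0; have [m [v [A [mA hA]]]] := step_approximation e0 bh h0.
  have bA : bounded_rv (fun x => \sum_j v j * \1_(A j) x).
    by apply: bounded_rv_sum => j; apply: bounded_rvZ; exact: bounded_rv_indic.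
  have hA1 x : h x <= \sum_j v j * \1_(A j) x by have /andP[] := hA x.
  have hA2 x : \sum_j v j * \1_(A j) x <= h x + e by have /andP[] := hA x.
  apply: (@le_trans _ _
    (mean Pr (fun w => \prod_(i < n) (\sum_j v j * \1_(A j) (X i w))))).
    apply: mean_le.
    - by apply: bounded_rv_prod => i; exact: (bounded_rv_comp (mX i) bh).
    - by apply: bounded_rv_prod => i; exact: (bounded_rv_comp (mX i) bA).
    - by move=> w; apply: ler_prod => i _; rewrite h0 hA1.
  have hAe : mean P (fun x => \sum_j v j * \1_(A j) x) <= mean P h + e.
    have -> : mean P h + e = mean P (fun x => h x + e).
      by rewrite meanD ?mean_cst//; exact: bounded_rv_cst.
    by apply: mean_le => //; apply: bounded_rvD => //; exact: bounded_rv_cst.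
  rewrite (iid_mean_prod_step v mA) lerXn2r// nnegrE.
    by rewrite mean_ge0// => x; rewrite (le_trans (h0 x)).
  by rewrite addr_ge0 ?mean_ge0// ltW.
have cvg : (mean P h + e) ^+ n @[e --> 0^'+] --> mean P h ^+ n.
  have -> : mean P h ^+ n = (mean P h + 0) ^+ n by rewrite addr0.
  apply: cvg_at_right_filter.
  apply: (@continuous_comp _ _ _ (fun e => mean P h + e) (fun y : R => y ^+ n)).
    by apply: continuousD => //; exact: cvg_cst.
  exact: exprn_continuous.
by apply: (cvgr_to_ge cvg); near=> e; apply: he.
Unshelve. all: by end_near. Qed.

Lemma bounded_rv_expR (Y : T -> R) (s m : R) : bounded_rv Y -> 0 <= s ->
  bounded_rv (fun x => expR (s * (Y x - m))).
Proof.
move=> [mY [l Yl]] s0; split.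
  apply: (measurableT_comp (@measurable_expR R)); apply: measurable_funM => //.
  exact: measurable_funB.
exists (expR (s * (l - m))) => x; rewrite ger0_norm ?expR_ge0// ler_expR.
by rewrite ler_wpM2l// lerD2r (le_trans (ler_norm _)).
Qed.

(** Hoeffding's lemma. Replacing the exponential by its chord over [[- l, l]] leaves an affine
    function of [Y], whose mean is bounded by [hoeffding_cosh] at [m / l] and [s * l]. *)
Lemma mean_expR_le (Y : T -> R) (l s : R) : bounded_rv Y -> 0 < l -> 0 <= s ->
  (forall x, `|Y x| <= l) ->
  mean P (fun x => expR (s * (Y x - mean P Y))) <= expR (s ^+ 2 * l ^+ 2 / 2).
Proof.
move=> bY l0 s0 Yl; set m := mean P Y.
have ln0 : l != 0 by rewrite gt_eqF.
have Yl1 x : -1 <= Y x / l <= 1.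
  by rewrite ler_pdivlMr// ler_pdivrMr// mulN1r mul1r -ler_norml.
have ml1 : -1 <= m / l <= 1.
  by rewrite ler_pdivlMr// ler_pdivrMr// mulN1r mul1r -ler_norml mean_norm_le.
have bexp : bounded_rv (fun x => expR (s * (Y x - m))) by exact: bounded_rv_expR.
pose a := expR (s * l); pose b := expR (- (s * l)).
(* [p + q * y] is the chord of y -> exp(s (y - m)) through the points [- l] and [l]. *)
pose p := expR (- (s * m)) * ((a + b) / 2).
pose q := expR (- (s * m)) * ((a - b) / (2 * l)).
apply: (@le_trans _ _ (mean P (fun x => p + q * Y x))).
  apply: mean_le => // [|x].
    by apply: bounded_rvD; [exact: bounded_rv_cst|exact: bounded_rvZ].
  have -> : s * (Y x - m) = - (s * m) + (s * l) * (Y x / l) by field.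
  rewrite expRD; apply: le_trans (ler_wpM2l (expR_ge0 _) (expR_chord (s * l) (Yl1 x))) _.
  by rewrite /p /q -/a -/b le_eqVlt; apply/orP; left; apply/eqP; field.
rewrite meanD; [|exact: bounded_rv_cst|exact: bounded_rvZ].
rewrite mean_cst meanZ// -/m.
have -> : p + q * m = expR (- (s * m)) * ((1 + m / l) / 2 * a + (1 - m / l) / 2 * b).
  by rewrite /p /q; field.
have sl0 : 0 <= s * l by rewrite mulr_ge0// ltW.
apply: le_trans (ler_wpM2l (expR_ge0 _) (hoeffding_cosh ml1 sl0)) _.
by rewrite -expRD ler_expR le_eqVlt; apply/orP; left; apply/eqP; field.
Qed.

(** Chernoff's method: the indicator of [bad] is at most an exponential of the centred sum, whose
    mean factorises by independence. *)
Lemma hoeffding (Y : T -> R) (l t : R) : bounded_rv Y -> 0 < l -> 0 <= t ->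
  (0 < n)%N -> (forall x, `|Y x| <= l) ->
  let bad := [set w | t < n%:R^-1 * (\sum_(i < n) Y (X i w)) - mean P Y] in
  measurable bad /\ (Pr bad <= (expR (- (n%:R * t ^+ 2 / (2 * l ^+ 2))))%:E)%E.
Proof.
move=> bY l0 t0 n0 Yl bad; have [mX XP indep] := X_iid.
have bYX i : bounded_rv (fun w => Y (X i w)) by exact: (bounded_rv_comp (mX i) bY).
have mbad : measurable bad.
  rewrite -[bad]setTI; apply: measurable_fun_ltr => //.
  have [mS _] := @bounded_rv_sum _ _ _ _ (index_enum 'I_n) _ bYX.
  by apply: measurable_funB => //; exact: measurable_funM.
split=> //.
have nR0 : 0 < n%:R :> R by rewrite ltr0n.
have nn0 : n%:R != 0 :> R by rewrite gt_eqF.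
have ln0 : l != 0 by rewrite gt_eqF.
set m := mean P Y.
(* The minimiser of the exponent - s t + s^2 l^2 / 2 per sample. *)
pose s := t / l ^+ 2.
have s0 : 0 <= s by rewrite divr_ge0// sqr_ge0.
pose h x := expR (s * (Y x - m)).
have bh : bounded_rv h by exact: bounded_rv_expR.
have bhX : bounded_rv (fun w => \prod_(i < n) h (X i w)).
  by apply: bounded_rv_prod => i; exact: (bounded_rv_comp (mX i) bh).
rewrite -[Pr bad]fineK ?fin_num_measure// lee_fin -mean_indic//.
apply: (@le_trans _ _
  (mean Pr (fun w => expR (- (s * n%:R * t)) * \prod_(i < n) h (X i w)))).
  apply: mean_le => [||w]; [exact: bounded_rv_indic|exact: bounded_rvZ|].
  rewrite indicE; have [wb|wb] := boolP (w \in bad); last first.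
    by rewrite mulr_ge0 ?expR_ge0// prodr_ge0// => i _; exact: expR_ge0.
  move: wb; rewrite inE /bad/= -/m => wb.
  rewrite /h -expR_sum -expRD -[X in X <= _]expR0 ler_expR -mulr_sumr.
  rewrite sumrB/= sumr_const card_ord.
  rewrite addrC subr_ge0 -mulrA ler_wpM2l// -(mulr_natl m) lerBrDr.
  rewrite -ltrBDr opprK in wb.
  have := ltW wb; rewrite -(ler_pM2l nR0) mulrA divff// mul1r.
  by rewrite mulrDr.
rewrite meanZ//.
apply: le_trans (ler_wpM2l (expR_ge0 _) (iid_mean_prod_le bh (fun x => expR_ge0 _))) _.
have hle := mean_expR_le bY l0 s0 Yl.
apply: (@le_trans _ _ (expR (- (s * n%:R * t)) * expR (s ^+ 2 * l ^+ 2 / 2) ^+ n)).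
  rewrite ler_wpM2l ?expR_ge0// lerXn2r// ?nnegrE ?expR_ge0// mean_ge0// => x.
  exact: expR_ge0.
rewrite -expRM_natl -expRD ler_expR /s le_eqVlt; apply/orP; left; apply/eqP.
by field.
Qed.

End iid.

(** * Chaining *)

Lemma finite_union_bound (R : realType) d (Omega : measurableType d)
    (Pr : probability Omega R) (I : finType) (B : I -> set Omega) (b : R) :
  (forall i, measurable (B i)) -> (forall i, (Pr (B i) <= b%:E)%E) ->
  (Pr (\bigcup_i B i) <= (#|I|%:R * b)%:E)%E.
Proof.
move=> mB PB; have fI : finite_set [set: I] by exact: finite_finset.
apply: (le_trans (@content_sub_fsum _ _ _ Pr I setT (\bigcup_i B i) B _ _ _ _)) => //.
  exact: fin_bigcup_measurable.
rewrite fsbig_finite//=.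
apply: le_trans; first by apply: lee_sum => i _; exact: PB.
rewrite sumEFin lee_fin big_const_seq count_predT/=.
rewrite iter_addr addr0.
suff -> : size (finmap.enum_fset (fset_set [set: I])) = #|I|.
  by rewrite mulr_natl.
rewrite cardE; apply: perm_size; apply: uniq_perm.
all: rewrite ?enum_uniq ?finmap.fset_uniq// => i.
by rewrite in_fset_set// mem_set// mem_enum.
Qed.

Section chaining.
Context {R : realType} {d1 d2 : measure_display}.
Context {Omega : measurableType d1} {T : measurableType d2}.
Variables (Pr : probability Omega R) (P : probability T R).
Variables (n : nat) (X : 'I_n -> Omega -> T).

Definition deviation (g : T -> R) (w : Omega) : R :=
  n%:R^-1 * (\sum_(i < n) g (X i w)) - mean P g.

Lemma deviationB (f g : T -> R) w : bounded_rv f -> bounded_rv g ->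
  deviation (fun x => f x - g x) w = deviation f w - deviation g w.
Proof.
by move=> bf bg; rewrite /deviation meanB// sumrB mulrBr; ring.
Qed.

Lemma deviation_le (g : T -> R) (e : R) w : (0 < n)%N -> bounded_rv g ->
  (forall x, `|g x| <= e) -> deviation g w <= e + e.
Proof.
move=> n0 bg ge; apply: lerD; last first.
  by rewrite (le_trans (ler_norm _))// normrN mean_norm_le.
rewrite mulrC ler_pdivrMr ?ltr0n//.
apply: (@le_trans _ _ (\sum_(i < n) e)); last by rewrite sumr_const card_ord mulr_natr.
by apply: ler_sum => i _; rewrite (le_trans (ler_norm _)).
Qed.

(** The deviation of [q k j] telescopes along its chain of ancestors under [par], ending at level 0,
    where the functions vanish. Hoeffding's inequality for each link and a union bound over level
    [k.+1] cost probability [delta / 2 ^ k.+1], and these sum to at most [delta]. *)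
Lemma chaining (J : nat -> finType) (q : forall k, J k -> T -> R)
    (par : forall k, J k.+1 -> J k) (l : nat -> R) (delta : R) :
  iid_from Pr P X -> (0 < n)%N -> 0 < delta <= 1 ->
  (forall k j, bounded_rv (q k j)) -> (forall j x, q 0%N j x = 0) ->
  (forall k, 0 < l k) ->
  (forall k j x, `|q k.+1 j x - q k (par k j) x| <= l k) ->
  exists E, [/\ measurable E, ((1 - delta)%:E <= Pr E)%E &
    forall w, E w -> forall k j, deviation (q k j) w <=
      \sum_(i < k) l i *
        Num.sqrt (2 * ln (#|J i.+1|%:R * (2 ^ i.+1)%:R / delta) / n%:R)].
Proof.
move=> X_iid n0 /andP[d0 d1'] bq q0 l0 ql.
(* With this [A k] and the threshold [t k], the Hoeffding bound for one link is exactly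
   [(A k)^-1]. *)
pose A k : R := #|J k.+1|%:R * (2 ^ k.+1)%:R / delta.
pose t k := l k * Num.sqrt (2 * ln (A k) / n%:R).
pose link k j x := q k.+1 j x - q k (par k j) x.
have blink k j : bounded_rv (link k j) by apply: bounded_rvB.
pose bad k j := [set w | t k < deviation (link k j) w].
have t0 k : 0 <= t k by rewrite mulr_ge0 ?sqrtr_ge0// ltW.
have nR0 : 0 < n%:R :> R by rewrite ltr0n.
have badP k j : measurable (bad k j) /\ (Pr (bad k j) <= ((A k)^-1)%:E)%E.
  have [mb Pb] := hoeffding X_iid (blink k j) (l0 k) (t0 k) n0 (ql k j).
  split=> //; apply: le_trans Pb _; rewrite lee_fin.
  have J1 : 1 <= #|J k.+1|%:R :> R by rewrite ler1n; apply/card_gt0P; exists j.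
  have A1 : 1 <= A k.
    rewrite /A ler_pdivlMr// mul1r (le_trans d1')//.
    by apply: mulr_ege1 => //; rewrite ler1n expn_gt0.
  have A0 : 0 < A k by rewrite (lt_le_trans _ A1).
  rewrite /t exprMn sqr_sqrtr; last first.
    by rewrite divr_ge0 ?mulr_ge0 ?ln_ge0// ltW.
  rewrite (_ : _ / (2 * l k ^+ 2) = ln (A k)) ?expRN ?lnK//.
  by field; rewrite !gt_eqF.
pose B k := \bigcup_j bad k j.
have mB k : measurable (B k).
  by apply: fin_bigcup_measurable => [|j _]; [exact: finite_finset|have [] := badP k j].
have PB k : (Pr (B k) <= (delta / (2 ^ k.+1)%:R)%:E)%E.
  apply: (le_trans (@finite_union_bound _ _ _ Pr _ (bad k) (A k)^-1 _ _)).
  - by move=> j; have [] := badP k j.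
  - by move=> j; have [] := badP k j.
  rewrite lee_fin /A.
  (* An empty level is treated apart because its cardinal cannot be cancelled. *)
  have [->|J0] := eqVneq #|J k.+1|%:R (0 : R).
    by rewrite mul0r divr_ge0// ltW.
  rewrite le_eqVlt; apply/orP; left; apply/eqP; field.
  by rewrite J0 (gt_eqF d0) pnatr_eq0 -lt0n expn_gt0.
exists (~` \bigcup_k B k).
have mUB : measurable (\bigcup_k B k) by exact: bigcup_measurable.
split.
- exact: measurableC.
- rewrite probability_setC// EFinB leeB//.
  apply: (le_trans (@measure_sigma_subadditive _ _ _ Pr (\bigcup_k B k) B _ _ _)) => //.
  apply: (@le_trans _ _ (\sum_(k <oo) (delta / (2 ^ k.+1)%:R)%:E)%E).
    by apply: lee_nneseries => // k _; rewrite PB.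
  by apply: epsilon_trick0; exact: ltW.
- move=> w Ew; elim=> [j|k ih j].
    rewrite big_ord0 (_ : q 0%N j = cst 0) ?/deviation; last exact/funext.
    by rewrite mean_cst big1// mulr0 subr0.
  rewrite big_ord_recr/=.
  have -> : deviation (q k.+1 j) w = deviation (q k (par k j)) w + deviation (link k j) w.
    by rewrite deviationB//; ring.
  apply: lerD => //; rewrite leNgt; apply/negP => bw.
  by apply: Ew; exists k => //; exists j.
Qed.

End chaining.

(** * Dudley's entropy integral *)

Section antitone_integral.
Context {R : realType}.
Variable g : R -> \bar R.
Hypothesis g_antitone : forall s t, s <= t -> (g t <= g s)%E.
Hypothesis g_ge0 : forall t, (0 <= g t)%E.

(** The set where an antitone function exceeds a given level is an interval. *)
Lemma antitone_measurable (D : set R) : measurable D -> measurable_fun D g.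
Proof.
move=> mD; apply: (@measurable_funS _ _ _ _ setT) => // _.
apply: (measurability _ (ErealGenOInfty.measurableE R)) => //.
move=> /= _ [_ [y ->] <-]; rewrite setTI; apply: is_interval_measurable.
move=> a b /=; rewrite !in_itv/= !andbT => ga gb z /andP[az zb].
by rewrite in_itv/= andbT (lt_le_trans gb)// g_antitone// ltW.
Qed.

(** A lower Riemann sum: [g] is at least [g (s k)] on []s k.+1, s k]], and these intervals are
    disjoint parts of the half-line. *)
Lemma antitone_step_le_integral (s : nat -> R) (K : nat) :
  (forall k, 0 < s k) -> (forall k, s k.+1 <= s k) ->
  (\sum_(k < K) (s k - s k.+1)%:E * g (s k) <=
    \int[lebesgue_measure]_(t in `]0%R, +oo[) g t)%E.
Proof.
move=> s0 sd.
have mg := antitone_measurable.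
have anti j k : (j <= k)%N -> s k <= s j.
  elim: k => [|k ih]; first by rewrite leqn0 => /eqP->.
  by rewrite leq_eqVlt => /predU1P[->//|/ih]; exact: le_trans.
apply: (@le_trans _ _ (\int[lebesgue_measure]_(t in `]s K, s 0%N]) g t)%E); last first.
  apply: ge0_subset_integral => //; first exact: mg.
  by move=> x /=; rewrite !in_itv/= andbT => /andP[/(lt_trans (s0 _))].
elim: K => [|K ih]; first by rewrite big_ord0 integral_ge0.
rewrite big_ord_recr/=.
have -> : `]s K.+1, s 0%N]%classic = `]s K, s 0%N] `|` `]s K.+1, s K].
  rewrite setUC -itv_bndbnd_setU// bnd_simp; [exact: sd|exact: anti].
rewrite ge0_integral_setU//=; [|by apply: mg; exact: measurableU|]; last first.
  rewrite disj_set2E; apply/eqP/seteqP; split=> // x [] /=.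
  rewrite !in_itv/= => /andP[+ _] /andP[_ +].
  by move=> /lt_le_trans /[apply]; rewrite ltxx.
apply: leeD => //.
apply: (@le_trans _ _ (\int[lebesgue_measure]_(t in `]s K.+1, s K]) cst (g (s K)) t)%E).
  rewrite integral_cst//= lebesgue_measure_itv/= lte_fin.
  case: ltP => [_|ss]; first by rewrite -EFinB muleC.
  rewrite mule0 (_ : s K - s K.+1 = 0) ?mul0e//.
  by apply/eqP; rewrite subr_eq0 eq_le ss sd.
apply: ge0_le_integral => //.
- by move=> x _; exact: g_ge0.
- exact: mg.
- by move=> x /=; rewrite in_itv/= => /andP[_ xs]; exact: g_antitone.
Qed.
End antitone_integral.

Section entropy.
Context {R : realType} {T : Type}.
Implicit Types (F : set (T -> R)).

Lemma packing_number_antitone F s t : s <= t ->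
  (packing_number F t <= packing_number F s)%E.
Proof.
move=> st; apply: le_ereal_sup => _ [m [p [pF pt]] <-]; exists m => //.
by exists p; split=> // i j /pt; exact: le_trans.
Qed.

Lemma packing_number_ge F t m (p : 'I_m -> T -> R) : is_packing F t p ->
  ((m%:R)%:E <= packing_number F t)%E.
Proof. by move=> pp; apply: ereal_sup_ubound; exists m => //; exists p. Qed.

Lemma packing_number_ge1 F t f : F f -> (1%:E <= packing_number F t)%E.
Proof.
move=> Ff; apply: (@packing_number_ge F t 1 (fun=> f)).
by split=> // i j; rewrite (ord1 i) (ord1 j).
Qed.

(** The integrand of [dudley]. *)
Definition entropy_root F t : \bar R := poweR (lne (packing_number F t)) 2^-1.

Lemma entropy_root_antitone F f s t : F f -> s <= t ->
  (entropy_root F t <= entropy_root F s)%E.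
Proof.
move=> Ff st; have N1 := packing_number_ge1 _ Ff.
have N0 u : (0 <= packing_number F u)%E by apply: le_trans (N1 u).
have L0 u : lne (packing_number F u) \in `[0%E, +oo%E].
  by rewrite in_itv/= leey andbT lne_ge0.
apply: gt0_ler_poweR; rewrite ?L0 ?invr_ge0//.
by rewrite lee_lne ?packing_number_antitone// in_itv/= leey andbT.
Qed.

(** If the packing number were infinite at [t], the integrand would be infinite on all of []t / 2,
    t]] by monotonicity, and the entropy integral would diverge. *)
Lemma packing_number_lty F f t : (dudley F < +oo)%E -> F f -> 0 < t ->
  (packing_number F t < +oo)%E.
Proof.
move=> Ffin Ff t0.
have := @antitone_step_le_integral R (entropy_root F)
  (fun s t => entropy_root_antitone Ff) (fun=> poweR_ge0 _ _)
  (fun k => t / 2 ^+ k) 1 _ _.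
rewrite big_ord1 /= expr0 expr1 divr1 => H.
have {}H : ((t - t / 2)%:E * entropy_root F t < +oo)%E.
  apply: le_lt_trans Ffin; apply: H => k.
    by rewrite divr_gt0// exprn_gt0.
  rewrite ler_pM2l// lef_pV2 ?posrE ?exprn_gt0// exprS ler_peMl ?exprn_ge0//.
  by rewrite ler1n.
rewrite ltNge leye_eq; apply/eqP => Ny; move: H.
rewrite /entropy_root Ny /= gt_eqF ?invr_gt0// gt0_muley ?ltxx// lte_fin; lra.
Qed.

(** A packing of the largest size is also a net: a member of [F] at distance at least [t] from all
    its points would extend it. *)
Lemma maximal_packing F t : (packing_number F t < +oo)%E ->
  exists m (p : 'I_m -> T -> R), is_packing F t p /\
    forall f, F f -> exists i, sup_norm (fun x => f x - p i x) < t.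
Proof.
move=> Nfin.
pose Q m := `[< exists p : 'I_m -> T -> R, is_packing F t p >].
have Q0 : exists m, Q m.
  by exists 0%N; apply/asboolP; exists (fun _ _ => 0); split => -[].
pose M := Num.truncn (fine (packing_number F t)).
have N0 : (0 <= packing_number F t)%E.
  apply: (@packing_number_ge F t 0 (fun _ _ => 0)); by split => -[].
have QM m : Q m -> (m <= M)%N.
  move=> /asboolP[p /packing_number_ge mN].
  rewrite /M -(@natrK R m) le_truncn//.
  by rewrite -lee_fin fineK// ge0_fin_numE.
case: (ex_maxnP Q0 QM) => m /asboolP[p pp] mmax.
exists m, p; split=> // f Ff; apply: contrapT => nf.
have far i : t <= sup_norm (fun x => f x - p i x).
  by rewrite leNgt; apply/negP => h; apply: nf; exists i.
have symm g h : sup_norm (fun x : T => g x - h x) = sup_norm (fun x => h x - g x) :> R.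
  rewrite /sup_norm; congr sup.
  by apply/seteqP; split=> _ [x _ <-]; exists x => //; rewrite distrC.
suff : Q m.+1 by move=> /mmax; rewrite ltnn.
apply/asboolP; exists (fun i => if unlift ord0 i is Some j then p j else f).
have [pF pt] := pp; split=> [i|i j].
  by case: unliftP.
case: unliftP => [i'|] ->; case: unliftP => [j'|] -> // ij.
- by apply: pt; apply: contraNneq ij => ->.
- by rewrite symm.
Qed.

(** The lower sum of the entropy integral at the scales [s k], where the packing number is at least
    [m k]. *)
Lemma packing_sum_le_dudley F f (s : nat -> R) (m : nat -> nat)
    (p : forall k, 'I_(m k) -> T -> R) K : (dudley F < +oo)%E -> F f ->
  (forall k, 0 < s k) -> (forall k, s k.+1 <= s k) ->
  (forall k, is_packing F (s k) (p k)) -> (forall k, (0 < m k)%N) ->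
  \sum_(k < K) (s k - s k.+1) * Num.sqrt (ln (m k)%:R) <= fine (dudley F).
Proof.
move=> Ffin Ff s0 sd pp m0.
have D0 : (0 <= dudley F)%E by apply: integral_ge0 => x _; exact: poweR_ge0.
rewrite -lee_fin fineK ?ge0_fin_numE//.
apply: le_trans; last exact: (@antitone_step_le_integral R (entropy_root F)
  (fun s t => entropy_root_antitone Ff) (fun=> poweR_ge0 _ _) s K s0 sd).
rewrite -sumEFin; apply: lee_sum => k _.
rewrite EFinM lee_wpmul2l ?lee_fin ?subr_ge0//.
have m1 : 1 <= (m k)%:R :> R by rewrite ler1n.
rewrite -powR12_sqrt ?ln_ge0// -poweR_EFin -lne_EFin ?ltr0n//.
have mN := packing_number_ge (pp k).
have N0 : (0 <= packing_number F (s k))%E by apply: le_trans mN.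
have L1 : (0 <= lne ((m k)%:R : R)%:E)%E by rewrite lne_ge0 lee_fin.
have LN : (lne ((m k)%:R : R)%:E <= lne (packing_number F (s k)))%E.
  by rewrite lee_lne// in_itv/= leey andbT// lee_fin.
apply: gt0_ler_poweR; rewrite ?invr_ge0// in_itv/= leey andbT//.
exact: le_trans LN.
Qed.

End entropy.

(** * Costs on a compact metric space *)

Lemma measurable_to_generated d (S : measurableType d) (T : pointedType)
    (G : set (set T)) (f : S -> g_sigma_algebraType G) :
  (forall U, G U -> measurable (f @^-1` U)) -> measurable_fun [set: S] f.
Proof.
move=> mf; apply: (@measurability _ _ S (g_sigma_algebraType G) setT f G) => //.
by move=> /= _ [U GU <-]; rewrite setTI; exact: mf.
Qed.

Lemma measurable_from_generated (R : realType) (T : pointedType)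
    (G : set (set T)) (f : g_sigma_algebraType G -> R) :
  (forall U : set R, open U -> G (f @^-1` U)) ->
  measurable_fun [set: g_sigma_algebraType G] f.
Proof.
move=> Gf; apply: (measurability _ (RGenOInfty.measurableE R)) => //.
move=> /= _ [_ [y ->] <-]; rewrite setTI; apply: sub_sigma_algebra.
by apply: Gf; exact: interval_open.
Qed.

Section compact_cost.
Context {R : realType} {Xi : pmetricType R}.

(** Couplings live on the Borel sets of the product topology, so the projections are measurable
    because they are continuous. *)
Lemma borel_fst : measurable_fun setT (fst : borel (Xi * Xi)%type -> borel Xi).
Proof.
apply: measurable_to_generated => U oU; apply: sub_sigma_algebra.
by apply: open_comp => // z _; exact: cvg_fst.
Qed.

Lemma borel_snd : measurable_fun setT (snd : borel (Xi * Xi)%type -> borel Xi).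
Proof.
apply: measurable_to_generated => U oU; apply: sub_sigma_algebra.
by apply: open_comp => // z _; exact: cvg_snd.
Qed.

Lemma continuous_borel (f : Xi -> R) : continuous f ->
  measurable_fun setT (f : borel Xi -> R).
Proof.
move=> cf; apply: measurable_from_generated => U oU.
by apply: open_comp => // x _; exact: cf.
Qed.

Lemma continuous_borel2 (f : Xi * Xi -> R) : continuous f ->
  measurable_fun setT (f : borel (Xi * Xi)%type -> R).
Proof.
move=> cf; apply: measurable_from_generated => U oU.
by apply: open_comp => // x _; exact: cf.
Qed.

Hypothesis Xi_compact : compact [set: Xi].

Lemma continuous_bounded (f : Xi -> R) : continuous f ->
  exists M, forall x, `|f x| <= M.
Proof.
move=> cf; have : compact (f @` setT).
  by apply: continuous_compact => //; exact: continuous_subspaceT.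
move=> /compact_bounded[M [_ /(_ (M + 1))]] fM; exists (M + 1) => x.
by apply: fM; [rewrite ltrDl|exists x].
Qed.

Lemma continuous_bounded_rv (f : Xi -> R) : continuous f ->
  bounded_rv (f : borel Xi -> R).
Proof. by move=> cf; split; [exact: continuous_borel|exact: continuous_bounded]. Qed.

Variable c : Xi -> Xi -> R.
Hypothesis c_cont : continuous (fun z : Xi * Xi => c z.1 z.2).

Lemma cost_bounded : exists C, forall x y, `|c x y| <= C.
Proof.
have : compact ((fun z : Xi * Xi => c z.1 z.2) @` setT).
  apply: continuous_compact; first exact: continuous_subspaceT.
  by rewrite -setXTT; exact: compact_setX.
move=> /compact_bounded[M [_ /(_ (M + 1))]] fM; exists (M + 1) => x y.
by apply: fM; [rewrite ltrDl|exists (x, y)].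
Qed.

Lemma cost_bounded_rv :
  bounded_rv ((fun z => c z.1 z.2) : borel (Xi * Xi)%type -> R).
Proof.
split; first exact: continuous_borel2.
by have [C cC] := cost_bounded; exists C => z; exact: cC.
Qed.

(** Joint continuity gives the estimate on a product neighbourhood of each [(x, y)]; compactness in
    [y] makes one neighbourhood of [x] serve all [y]. *)
Lemma cost_equicontinuous (x : Xi) (e : R) : 0 < e ->
  \forall x' \near x, forall y, `|c x y - c x' y| <= e.
Proof.
move=> e0; have e20 : 0 < e / 2 by rewrite divr_gt0.
move/compact_near_coveringP : Xi_compact => /(_ Xi (nbhs x)
  (fun x' y => `|c x y - c x' y| <= e) _) H.
have {}H : \forall x' \near x, [set: Xi] `<=` (fun y => `|c x y - c x' y| <= e).
  apply: H => y _.
  have cy : \forall z \near (x, y), `|c x y - c z.1 z.2| < e / 2.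
    by have /cvgrPdist_lt/(_ _ e20) := @c_cont (x, y); exact.
  have [[A B] [/= nA nB] AB] := cy; exists (B, A) => //= -[y' x'] [/= By Ax].
  have h1 := AB (x', y') (conj Ax By).
  have h2 := AB (x, y') (conj (nbhs_singleton nA) By).
  rewrite /= in h1 h2.
  rewrite -[c x y' - _](subrKA (c x y)) (le_trans (ler_normD _ _))//.
  by rewrite distrC [e]splitr lerD// ltW.
by apply: filterS H => x' H y; exact: H.
Qed.

End compact_cost.

(** * The dual generator: regularity, convexity, near-optimal selections *)

Section dual_generator_theory.
Context {R : realType} {Xi : pmetricType R}.
Variable c : Xi -> Xi -> R.
Hypothesis c_ge0 : forall x y, 0 <= c x y.
Hypothesis c_diag : forall x, c x x = 0.

Notation phi := (dual_generator c).

(** The real-valued [sup] is a true supremum only on nonempty sets bounded above. This is why the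
    lemmas below carry a bound [M] on [f]. *)
Lemma dual_has_sup (f : Xi -> R) M l x : 0 <= l -> (forall y, `|f y| <= M) ->
  has_sup [set f zeta - l * c x zeta | zeta in [set: Xi]].
Proof.
move=> l0 fM; split; first by exists (f x - l * c x x); exists x.
exists M => _ [y _ <-]; rewrite lerBlDr (le_trans (ler_norm _))//.
by rewrite (le_trans (fM y))// lerDl mulr_ge0.
Qed.

Lemma dual_ge (f : Xi -> R) M l x y : 0 <= l -> (forall y, `|f y| <= M) ->
  f y - l * c x y <= phi l f x.
Proof.
by move=> l0 fM; apply: ub_le_sup; [have [] := dual_has_sup x l0 fM|exists y].
Qed.

Lemma dual_le (f : Xi -> R) l x b : (forall y, f y - l * c x y <= b) ->
  phi l f x <= b.
Proof.
move=> fb; apply: ge_sup; first by exists (f x - l * c x x); exists x.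
by move=> _ [y _ <-].
Qed.

Lemma dual_ge_diag (f : Xi -> R) M l x : 0 <= l -> (forall y, `|f y| <= M) ->
  f x <= phi l f x.
Proof. by move=> l0 fM; have := dual_ge x x l0 fM; rewrite c_diag mulr0 subr0. Qed.

Lemma dual_norm_le (f : Xi -> R) M l x : 0 <= l -> (forall y, `|f y| <= M) ->
  `|phi l f x| <= M.
Proof.
move=> l0 fM; rewrite ler_norml; apply/andP; split.
  apply: le_trans (dual_ge_diag x l0 fM).
  by have := fM x; rewrite ler_norml => /andP[].
apply: dual_le => y; rewrite lerBlDr (le_trans (ler_norm _))//.
by rewrite (le_trans (fM y))// lerDl mulr_ge0.
Qed.

Lemma dual_lipschitz (f g : Xi -> R) M N l x e : 0 <= l ->
  (forall y, `|f y| <= M) -> (forall y, `|g y| <= N) ->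
  (forall y, `|f y - g y| <= e) -> `|phi l f x - phi l g x| <= e.
Proof.
move=> l0 fM gN fge; rewrite ler_distlC; apply/andP; split.
  rewrite lerBlDr; apply: dual_le => y.
  have := dual_ge x y l0 gN; have := fge y; rewrite ler_distlC => /andP[]; lra.
apply: dual_le => y.
have := dual_ge x y l0 fM; have := fge y; rewrite ler_distlC => /andP[]; lra.
Qed.

Lemma dual_nonincreasing (f : Xi -> R) M l1 l2 x : 0 <= l1 -> l1 <= l2 ->
  (forall y, `|f y| <= M) -> phi l2 f x <= phi l1 f x.
Proof.
move=> l0 l12 fM; apply: dual_le => y; apply: le_trans (dual_ge x y l0 fM).
by rewrite lerD2l lerN2 ler_wpM2r.
Qed.

(** A supremum of functions affine in the multiplier is convex; the three-chord form avoids
    division. *)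
Lemma dual_convex (f : Xi -> R) M a b d x : 0 <= a -> a < b -> b < d ->
  (forall y, `|f y| <= M) ->
  (d - a) * phi b f x <= (d - b) * phi a f x + (b - a) * phi d f x.
Proof.
move=> a0 ab bd fM; rewrite mulrC -ler_pdivlMr ?subr_gt0 ?(lt_trans ab)//.
apply: dual_le => y; rewrite ler_pdivlMr ?subr_gt0 ?(lt_trans ab)//.
have d0 : 0 <= d by rewrite (le_trans a0)// ltW// (lt_trans ab).
have := dual_ge x y a0 fM; have := dual_ge x y d0 fM.
set u := phi a f x; set w := phi d f x => h1 h2.
have ab0 : 0 <= b - a by rewrite subr_ge0 ltW.
have bd0 : 0 <= d - b by rewrite subr_ge0 ltW.
have := ler_wpM2l ab0 h1; have := ler_wpM2l bd0 h2; lra.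
Qed.

(** Trades the unbounded multiplier for the scaling factor [mu] of [f], which ranges over a bounded
    interval once the multiplier is bounded below. *)
Lemma dual_scale (f : Xi -> R) M mu x : 0 < mu -> (forall y, `|f y| <= M) ->
  phi 1 (fun y => mu * f y) x = mu * phi mu^-1 f x.
Proof.
move=> mu0 fM; have muV0 : 0 <= mu^-1 by rewrite invr_ge0 ltW.
have mufM y : `|mu * f y| <= mu * M by rewrite normrM gtr0_norm// ler_pM2l.
apply/eqP; rewrite eq_le; apply/andP; split.
  apply: dual_le => y.
  have -> : mu * f y - 1 * c x y = mu * (f y - mu^-1 * c x y).
    by rewrite mulrBr mul1r mulrA divff ?mul1r// gt_eqF.
  by rewrite ler_pM2l//; exact: dual_ge fM.
rewrite mulrC -ler_pdivlMr//; apply: dual_le => y; rewrite ler_pdivlMr//.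
apply: le_trans (dual_ge x y ler01 mufM).
by rewrite mulrBl mul1r mulrAC mulVf ?mul1r ?gt_eqF// mulrC.
Qed.

Hypothesis Xi_compact : compact [set: Xi].
Hypothesis c_cont : continuous (fun z : Xi * Xi => c z.1 z.2).

Lemma dual_continuous (f : Xi -> R) M l : 0 <= l -> (forall y, `|f y| <= M) ->
  continuous (phi l f).
Proof.
(* The margin is divided by [l + 1], since [l] may be 0. *)
move=> l0 fM x; have l1 : 0 < l + 1 by rewrite ltr_wpDl.
apply/cvgrPdist_le => e e0; near=> x'.
have cc y : `|c x y - c x' y| <= e / (l + 1).
  by move: y; near: x'; apply: (cost_equicontinuous Xi_compact c_cont); exact: divr_gt0.
have lc y : `|l * c x y - l * c x' y| <= e.
  rewrite -mulrBr normrM ger0_norm//.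
  apply: (@le_trans _ _ ((l + 1) * (e / (l + 1)))).
    by rewrite ler_pM// lerDl.
  by rewrite mulrC divfK// gt_eqF.
rewrite ler_distlC; apply/andP; split.
  rewrite lerBlDr; apply: dual_le => y.
  have := dual_ge x' y l0 fM; have := lc y; rewrite ler_distlC => /andP[]; lra.
apply: dual_le => y.
have := dual_ge x y l0 fM; have := lc y; rewrite ler_distlC => /andP[]; lra.
Unshelve. all: by end_near. Qed.

Lemma dual_bounded_rv (f : Xi -> R) M l : 0 <= l -> (forall y, `|f y| <= M) ->
  bounded_rv (phi l f : borel Xi -> R).
Proof.
move=> l0 fM; split; first by apply: continuous_borel; exact: dual_continuous fM.
by exists M => x; exact: dual_norm_le.
Qed.

(** [T x] is the first [z] of the list with [U z x], so [T] is constant on finitely many Borel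
    pieces. Measurability is proved for the graph map, along which [P] is later pushed forward to
    the product. *)
Lemma measurable_choice_seq (U : Xi -> set Xi) (s : seq Xi) :
  (forall z, open (U z)) ->
  exists T : Xi -> Xi,
    measurable_fun setT ((fun x => (x, T x)) : borel Xi -> borel (Xi * Xi)%type) /\
    forall x, (exists2 z, z \in s & U z x) -> U (T x) x.
Proof.
move=> oU; elim: s => [|z s [T [mT TU]]].
  exists (fun=> point); split; last by move=> x [].
  apply: measurable_to_generated => V oV; apply: sub_sigma_algebra.
  apply: open_comp oV => x _.
  by apply: cvg_pair; [exact: cvg_id|exact: cvg_cst].
have mU : measurable (U z : set (borel Xi)) by apply: sub_sigma_algebra.
exists (fun x => if pselect (U z x) then z else T x); split.
  apply: measurable_to_generated => V oV.
  rewrite (_ : _ @^-1` V = (U z `&` (fun x => (x, z)) @^-1` V) `|`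
      (~` U z `&` (fun x => (x, T x)) @^-1` V)); last first.
    apply/seteqP; split => x /=; case: pselect => Ux /=.
    - by move=> ?; left.
    - by move=> ?; right.
    - by move=> [[]|[]].
    - by move=> [[]|[]].
  apply: measurableU; apply: measurableI => //.
  - apply: sub_sigma_algebra; apply: open_comp oV => x _.
    by apply: cvg_pair; [exact: cvg_id|exact: cvg_cst].
  - exact: measurableC.
  - rewrite -[X in measurable X]setTI; apply: mT => //.
    exact: sub_sigma_algebra.
move=> x [y]; rewrite inE => /predU1P[->|ys] Uyx; case: pselect => //= nU.
by apply: TU; exists y.
Qed.

(** The points [x] at which a given [z] is [e]-optimal form an open set. Finitely many of these sets
    cover the compact space, which gives a finitely valued measurable selection. *)
Lemma dual_selection (f : Xi -> R) l e : continuous f -> 0 <= l -> 0 < e ->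
  exists T : Xi -> Xi,
    measurable_fun setT ((fun x => (x, T x)) : borel Xi -> borel (Xi * Xi)%type) /\
    forall x, phi l f x - e <= f (T x) - l * c x (T x).
Proof.
move=> cf l0 e0; have [M fM] := continuous_bounded Xi_compact cf.
pose h z x := f z - l * c x z - phi l f x.
pose U z := [set x | - e < h z x].
have cslice z : continuous (c ^~ z).
  move=> x; apply: (@continuous_comp _ _ _ (fun x => (x, z)) (fun z => c z.1 z.2)).
    by apply: cvg_pair; [exact: cvg_id|exact: cvg_cst].
  exact: c_cont.
have oU z : open (U z).
  rewrite (_ : U z = h z @^-1` [set` `]- e, +oo[]); last first.
    by apply/seteqP; split => x /=; rewrite in_itv/= andbT.
  apply: open_comp; last exact: interval_open.
  move=> x _; apply: cvgB; last exact: dual_continuous fM _.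
  by apply: cvgB; [exact: cvg_cst|apply: cvgM; [exact: cvg_cst|exact: cslice]].
have covU : [set: Xi] `<=` \bigcup_(z in [set: Xi]) U z.
  move=> x _; have [_ [z _ <-] hz] := sup_adherent e0 (dual_has_sup x l0 fM).
  by exists z => //; rewrite /U/= /h ltrBrDr addrC.
move: Xi_compact; rewrite compact_cover => /(_ Xi setT U (fun z _ => oU z) covU)[s _ sU].
have [T [mT TU]] := measurable_choice_seq (finmap.enum_fset s) oU.
exists T; split=> // x.
have : U (T x) x by apply: TU; have [z zs Uz] := sU x I; exists z.
rewrite /U/= /h; lra.
Qed.

End dual_generator_theory.

(** * Duality *)

Lemma exists_pushforward (R : realType) d1 d2 (S : measurableType d1)
    (T : measurableType d2) (P : probability S R) (f : S -> T) :
  measurable_fun setT f ->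
  exists Q : probability T R, forall A, measurable A -> pushforward P f A = Q A.
Proof.
move=> mf; pose f' : {mfun S >-> T} := HB.pack f (isMeasurableFun.Build _ _ _ _ f mf).
by exists (distribution P f').
Qed.

Section mixture.
Context {R : realType} {d : measure_display} {T : measurableType d}.
Variables (P1 P2 : probability T R) (t : R).
Hypothesis t01 : 0 <= t <= 1.

Let t0 : 0 <= t. Proof. by case/andP: t01. Qed.
Let u0 : 0 <= 1 - t. Proof. by rewrite subr_ge0; case/andP: t01. Qed.

Definition mixture : set T -> \bar R :=
  measure_add (mscale (NngNum t0) P1) (mscale (NngNum u0) P2).

HB.instance Definition _ := Measure.copy mixture
  (measure_add (mscale (NngNum t0) P1) (mscale (NngNum u0) P2)).

Let mixtureE A : mixture A = (t%:E * P1 A + (1 - t)%:E * P2 A)%E.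
Proof. exact: (measure_addE (mscale (NngNum t0) P1) (mscale (NngNum u0) P2) A). Qed.

Let mixture_setT : mixture setT = 1%E.
Proof.
rewrite mixtureE [P1 _]probability_setT [P2 _]probability_setT !mule1 -EFinD.
by rewrite addrC subrK.
Qed.

HB.instance Definition _ := Measure_isProbability.Build d T R mixture mixture_setT.

Lemma exists_mixture : exists Q : probability T R,
  (forall A, Q A = (t%:E * P1 A + (1 - t)%:E * P2 A)%E) /\
  (forall g, bounded_rv g -> mean Q g = t * mean P1 g + (1 - t) * mean P2 g).
Proof.
pose Q : probability T R := mixture.
have QE A : Q A = (t%:E * P1 A + (1 - t)%:E * P2 A)%E by exact: mixtureE.
exists Q; split=> //.
(* The formula is proved for nonnegative functions; a general bounded one is shifted by its bound
   [M]. *)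
have ge0E g : bounded_rv g -> (forall x, 0 <= g x) ->
    mean Q g = t * mean P1 g + (1 - t) * mean P2 g.
  move=> bg g0; apply: EFin_inj; rewrite -meanE// EFinD !EFinM -!meanE//.
  have mg : measurable_fun setT (EFin \o g) by apply/measurable_EFinP; case: bg.
  have g0' x : setT x -> (0 <= (EFin \o g) x)%E by rewrite /= lee_fin.
  rewrite (_ : \int[Q]_x (g x)%:E = \int[measure_add (mscale (NngNum t0) P1)
    (mscale (NngNum u0) P2)]_x (g x)%:E)%E; last by apply: eq_measure_integral.
  by rewrite ge0_integral_measure_add// !ge0_integral_mscale.
move=> g bg; have [_ [M gM]] := bg.
have bM : bounded_rv (cst M : T -> R) by exact: bounded_rv_cst.
have H := ge0E _ (bounded_rvD bg bM).
have {}H : mean Q (fun x => g x + M) =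
    t * mean P1 (fun x => g x + M) + (1 - t) * mean P2 (fun x => g x + M).
  apply: H => x; have := gM x; rewrite ler_norml => /andP[]; rewrite /cst/=; lra.
have E P : mean P (fun x => g x + M) = mean P g + M by rewrite meanD// mean_cst.
rewrite !E in H; lra.
Qed.
End mixture.

(** [A] is a convex set in the plane that stays below height [v] up to abscissa [r]. The slope [l]
    is the supremum of the slopes from [(r, v)] to the points of [A] on the right; the point
    [(x0, y0)] on the left keeps it finite. *)
Lemma supporting_line (R : realType) (A : R -> R -> Prop) (r v x0 y0 : R) :
  (forall x1 y1 x2 y2 t, A x1 y1 -> A x2 y2 -> 0 <= t <= 1 ->
     A (t * x1 + (1 - t) * x2) (t * y1 + (1 - t) * y2)) ->
  A x0 y0 -> x0 < r -> (forall x y, A x y -> x <= r -> y <= v) ->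
  exists2 l, 0 <= l & forall x y, A x y -> y <= v + l * (x - r).
Proof.
move=> Aconv A0 x0r Av.
(* Including 0 makes the set nonempty and its supremum nonnegative. *)
pose S := [set s | s = 0 \/ exists x y, [/\ A x y, r < x & s = (y - v) / (x - r)]].
(* Slopes to the right never exceed slopes to the left: otherwise the segment joining the two points
   would pass above [(r, v)]. *)
have slope_le x' y' s : A x' y' -> x' < r -> S s -> s <= (v - y') / (r - x').
  move=> A' x'r; have rx' : 0 < r - x' by rewrite subr_gt0.
  move=> [->|[x [y [Axy rx ->]]]].
    by rewrite divr_ge0// ?subr_ge0 ?(ltW x'r)// (Av _ _ A')// ltW.
  have xr : 0 < x - r by rewrite subr_gt0.
  have xx' : 0 < x - x' by rewrite subr_gt0 (lt_trans x'r).
  rewrite ler_pdivrMr// mulrAC ler_pdivlMr//.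
  (* The weight at which the segment crosses abscissa [r]. *)
  pose t := (x - r) / (x - x').
  have t01 : 0 <= t <= 1.
    apply/andP; split; first by rewrite divr_ge0// ltW.
    by rewrite ler_pdivrMr// mul1r lerD2l lerN2 ltW.
  have xx'n : x - x' != 0 by rewrite gt_eqF.
  have tr : t * x' + (1 - t) * x = r by rewrite /t; field.
  have := Av _ _ (Aconv _ _ _ _ _ A' Axy t01); rewrite tr => /(_ (lexx _)).
  have -> : t * y' + (1 - t) * y = ((x - r) * y' + (r - x') * y) / (x - x').
    by rewrite /t; field.
  rewrite ler_pdivrMr//; lra.
have S0 : S 0 by left.
have hS : has_sup S.
  by split; [exists 0|exists ((v - y0) / (r - x0)) => s; exact: slope_le].
exists (sup S); first by apply: ub_le_sup S0; exact: hS.2.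
move=> x y Axy; have [xr|rx|xr] := ltgtP x r.
- have rx : 0 < r - x by rewrite subr_gt0.
  have : sup S <= (v - y) / (r - x).
    by apply: ge_sup => [|s]; [exact: hS.1|exact: slope_le].
  rewrite ler_pdivlMr//; lra.
- have xr : 0 < x - r by rewrite subr_gt0.
  have : (y - v) / (x - r) <= sup S.
    by apply: ub_le_sup; [exact: hS.2|right; exists x, y].
  rewrite ler_pdivrMr//; lra.
- by rewrite xr subrr mulr0 addr0 (Av _ _ Axy)// xr.
Qed.

Lemma ler_addgt0_mul (R : realType) (l x y : R) : 0 <= l ->
  (forall e, 0 < e -> x <= y + l * e) -> x <= y.
Proof.
move=> l0 H; apply/ler_addgt0Pr => e e0.
have l1 : 0 < l + 1 by rewrite ltr_wpDl.
apply: le_trans (H (e / (l + 1)) (divr_gt0 e0 l1)) _.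
rewrite lerD2l mulrA ler_pdivrMr// mulrDr mulr1 mulrC.
by rewrite lerDl ltW.
Qed.

Section duality.
Context {R : realType} {Xi : pmetricType R}.
Variable c : Xi -> Xi -> R.
Hypothesis c_ge0 : forall x y, 0 <= c x y.
Hypothesis c_diag : forall x, c x x = 0.
Hypothesis Xi_compact : compact [set: Xi].
Hypothesis c_cont : continuous (fun z : Xi * Xi => c z.1 z.2).

Notation phi := (dual_generator c).
Notation cost := ((fun z => c z.1 z.2) : borel (Xi * Xi)%type -> R).

Let bcost : bounded_rv cost. Proof. exact: cost_bounded_rv. Qed.

Lemma near_optimal_coupling (Q Q' : {measure set (borel Xi) -> \bar R}) (rho e : R) :
  (transport_cost c Q Q' <= rho%:E)%E -> 0 < e ->
  exists2 pi, is_coupling Q Q' pi & mean pi cost <= rho + e.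
Proof.
move=> W e0.
have : (transport_cost c Q Q' < (rho + e)%:E)%E.
  by rewrite (le_lt_trans W)// lte_fin ltrDl.
move=> /ereal_inf_lt[_ [pi cpi <-]].
by rewrite expectation_mean// lte_fin => /ltW; exists pi.
Qed.

(** Integrate f(y) <= phi(l, f, x) + l c(x, y) against a nearly optimal coupling. [Q] is only a
    measure, so that [empirical] fits; its integral of phi enters as the common value [b] over all
    couplings. *)
Lemma weak_duality (Q : {measure set (borel Xi) -> \bar R}) (rho l b : R) (f : Xi -> R) :
  continuous f -> 0 <= l ->
  (forall Q' pi, is_coupling Q Q' pi -> mean pi (fun z => phi l f z.1) = b) ->
  (robust_risk c rho Q f <= (l * rho + b)%:E)%E.
Proof.
move=> cf l0 Qb; have [M fM] := continuous_bounded Xi_compact cf.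
have bf := continuous_bounded_rv Xi_compact cf.
apply: ge_ereal_sup => _ [Q' W <-]; rewrite expectation_mean// lee_fin.
apply: (@ler_addgt0_mul _ l) => // e e0.
have [pi cpi pic] := near_optimal_coupling W e0.
have -> : mean Q' f = mean pi (f \o snd).
  by apply: mean_comp => //; [exact: borel_snd|move=> A /cpi[]].
have bphi : bounded_rv ((fun z => phi l f z.1) : borel (Xi * Xi)%type -> R).
  by apply: (bounded_rv_comp borel_fst); exact: dual_bounded_rv fM.
apply: (@le_trans _ _ (mean pi (fun z => phi l f z.1 + l * c z.1 z.2))).
  apply: mean_le => [||z /=].
  - exact: (bounded_rv_comp borel_snd).
  - by apply: bounded_rvD => //; exact: bounded_rvZ.
  - by rewrite -lerBlDr; exact: dual_ge fM.
rewrite meanD ?meanZ//; last exact: bounded_rvZ.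
by rewrite (Qb _ _ cpi) addrC addrAC -mulrDr lerD2r ler_wpM2l.
Qed.

Variable P : probability (borel Xi) R.

Lemma robust_risk_le (rho l : R) (f : Xi -> R) : continuous f -> 0 <= l ->
  (robust_risk c rho P f <= (l * rho + mean P (phi l f))%:E)%E.
Proof.
move=> cf l0; have [M fM] := continuous_bounded Xi_compact cf.
apply: weak_duality => // Q' pi cpi; apply/esym.
apply: (mean_comp borel_fst); last exact: dual_bounded_rv fM.
by move=> A /cpi[].
Qed.

(** The multiplier is the slope of a supporting line of [A], the pairs (transport cost, mean of [f]
    under the second marginal) over all plans with first marginal [P]. Testing this line on graphs
    of near-optimal selections gives the bound. *)
Lemma strong_duality (rho : R) (f : Xi -> R) : continuous f -> 0 < rho ->
  exists2 l, 0 <= l & ((l * rho + mean P (phi l f))%:E <= robust_risk c rho P f)%E.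
Proof.
move=> cf rho0; have [M fM] := continuous_bounded Xi_compact cf.
have bf := continuous_bounded_rv Xi_compact cf.
have bfs : bounded_rv (f \o snd : borel (Xi * Xi)%type -> R).
  exact: (bounded_rv_comp borel_snd).
pose A x y := exists pi : probability (borel (Xi * Xi)%type) R,
  [/\ forall B : set (borel Xi), measurable B ->
        pushforward pi (fst : borel (Xi * Xi)%type -> borel Xi) B = P B,
      x = mean pi cost & y = mean pi (f \o snd)].
have Amap (T : Xi -> Xi) :
    measurable_fun setT ((fun x => (x, T x)) : borel Xi -> borel (Xi * Xi)%type) ->
    A (mean P (fun x => c x (T x))) (mean P (fun x => f (T x))).
  move=> mT; have [pi piE] := exists_pushforward P mT; exists pi; split.
  - move=> B mB; apply/esym; apply: (piE (fst @^-1` B)).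
    by rewrite -[X in measurable X]setTI; exact: borel_fst.
  - by rewrite (mean_comp mT piE).
  - by rewrite (mean_comp mT piE).
have AV x y : A x y -> x <= rho -> (y%:E <= robust_risk c rho P f)%E.
  move=> [pi [pi1 -> ->]] pirho.
  have [Q' Q'E] := exists_pushforward pi borel_snd.
  have -> : mean pi (f \o snd) = mean Q' f by rewrite (mean_comp borel_snd Q'E).
  rewrite -expectation_mean//; apply: ereal_sup_ubound; exists Q' => //.
  apply: (@le_trans _ _ (mean pi cost)%:E); last by rewrite lee_fin.
  apply: ereal_inf_lbound; exists pi; last by rewrite expectation_mean.
  by move=> B mB; split; [exact: pi1|exact: Q'E].
(* The diagonal plan has cost 0 < [rho]: this is the strictly feasible point that [supporting_line]
   requires. *)
have A0 : A (mean P (fun x => c x x)) (mean P f).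
  apply: (Amap id); apply: measurable_to_generated => V oV; apply: sub_sigma_algebra.
  by apply: open_comp oV => x _; apply: cvg_pair; exact: cvg_id.
rewrite (_ : mean P _ = 0) in A0; last first.
  by rewrite -(mean_cst P 0); congr mean; apply/funext => x; rewrite c_diag.
have Vfin : robust_risk c rho P f \is a fin_num.
  rewrite fin_real//; apply/andP; split.
    by rewrite (lt_le_trans (ltNyr (mean P f)))// (AV _ _ A0)// ltW.
  rewrite (@le_lt_trans _ _ M%:E) ?ltry//.
  apply: ge_ereal_sup => _ [Q' _ <-]; rewrite expectation_mean// lee_fin.
  by rewrite (le_trans (ler_norm _))// mean_norm_le.
pose v := fine (robust_risk c rho P f).
have Aconv x1 y1 x2 y2 t : A x1 y1 -> A x2 y2 -> 0 <= t <= 1 ->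
    A (t * x1 + (1 - t) * x2) (t * y1 + (1 - t) * y2).
  move=> [p1 [p1P -> ->]] [p2 [p2P -> ->]] t01.
  have [p [pE pmean]] := exists_mixture p1 p2 t01.
  exists p; split=> [B mB||]; rewrite ?pmean//.
  rewrite /pushforward pE.
  have -> : p1 (fst @^-1` B) = P B by exact: p1P.
  have -> : p2 (fst @^-1` B) = P B by exact: p2P.
  rewrite -(@fineK _ (P B)) ?fin_num_measure// -!EFinM -EFinD -mulrDl.
  by rewrite addrC subrK mul1r.
have Av x y : A x y -> x <= rho -> y <= v.
  by move=> /AV /[apply]; rewrite -lee_fin /v fineK.
have [l l0 lA] := supporting_line Aconv A0 rho0 Av.
exists l => //; rewrite -(fineK Vfin) lee_fin -/v.
apply/ler_addgt0Pr => e e0.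
have [T [mT TE]] := dual_selection c_ge0 Xi_compact c_cont cf l0 e0.
have := lA _ _ (Amap T mT).
have bcT : bounded_rv ((fun x => c x (T x)) : borel Xi -> R).
  exact: (bounded_rv_comp mT bcost).
have bfT : bounded_rv ((fun x => f (T x)) : borel Xi -> R).
  exact: (bounded_rv_comp mT bfs).
have bphi : bounded_rv (phi l f : borel Xi -> R) by exact: dual_bounded_rv fM.
have : mean P (fun x => phi l f x - e) <= mean P (fun x => f (T x) - l * c x (T x)).
  apply: mean_le => //.
  - by apply: bounded_rvB => //; exact: bounded_rv_cst.
  - by apply: bounded_rvB => //; exact: bounded_rvZ.
rewrite meanB ?mean_cst//; last exact: bounded_rv_cst.
rewrite meanB ?meanZ//; last exact: bounded_rvZ.
lra.
Qed.

(** Young's inequality for [x / a] and 1, with equality at x = a. *)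
Lemma powR_tangent (a x p : R) : 0 < a -> 0 <= x -> 1 <= p ->
  x <= a `^ (1 - p) / p * x `^ p + a * (1 - p^-1).
Proof.
(* For [p = 1] the conjugate exponent is infinite, so this case is separate. *)
move=> a0 x0; rewrite le_eqVlt => /predU1P[<-|p1].
  by rewrite subrr powRr0 invr1 subrr mulr0 addr0 !mul1r powRr1.
have p0 : 0 < p by rewrite (lt_trans ltr01).
have pn0 : p != 0 by rewrite gt_eqF.
have q0 : 0 < 1 - p^-1 by rewrite subr_gt0 invf_lt1.
have u0 : 0 <= x / a by rewrite divr_ge0// ltW.
have qV0 : 0 < (1 - p^-1)^-1 by rewrite invr_gt0.
have pq : p^-1 + (1 - p^-1)^-1^-1 = 1 by rewrite invrK; ring.
have := @conjugate_powR R (x / a) 1 p (1 - p^-1)^-1 u0 ler01 p0 qV0 pq.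
rewrite mulr1 powR1 invrK mul1r ler_pdivrMr// => /le_trans; apply.
have -> : (x / a) `^ p = x `^ p * a `^ (- p).
  by rewrite powRM ?invr_ge0 ?(ltW a0)// -[a^-1]powR_inv1 ?ltW// -powRrM mulN1r.
have -> : a `^ (1 - p) = a * a `^ (- p).
  by rewrite powRD ?(gt_eqF a0) ?implybT// powRr1 ?ltW.
by rewrite le_eqVlt; apply/orP; left; apply/eqP; ring.
Qed.

Lemma robust_risk_lipschitz_le (rho p Lip : R) (f : Xi -> R) : continuous f ->
  0 < rho -> 1 <= p -> 0 <= Lip ->
  (forall xi zeta, c xi zeta = mdist xi zeta `^ p) ->
  (forall xi zeta, `|f xi - f zeta| <= Lip * mdist xi zeta) ->
  (robust_risk c rho P f <= 'E_P[f] + (Lip * rho `^ (1 / p))%:E)%E.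
Proof.
move=> cf rho0 p1 L0 cE fL.
have p0 : 0 < p by rewrite (lt_le_trans ltr01).
have pn0 : p != 0 by rewrite gt_eqF.
have bf := continuous_bounded_rv Xi_compact cf.
have [M fM] := continuous_bounded Xi_compact cf.
pose a := rho `^ (1 / p).
have a0 : 0 < a by rewrite powR_gt0.
(* The minimiser of l rho + max_t (Lip t - l t^p). The maximum is at t = a and contributes Lip a (1
   - 1/p), while l rho = Lip a / p; together they give Lip a. *)
pose l := Lip * (a `^ (1 - p) / p).
have l0 : 0 <= l by rewrite !mulr_ge0 ?powR_ge0// invr_ge0 ltW.
apply: le_trans (robust_risk_le _ cf l0) _.
rewrite expectation_mean// -EFinD lee_fin.
have : mean P (phi l f) <= mean P (fun x => f x + Lip * (a * (1 - p^-1))).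
  apply: mean_le => [||x]; first exact: dual_bounded_rv fM.
    by apply: bounded_rvD => //; exact: bounded_rv_cst.
  apply: dual_le => // y; rewrite cE.
  have := fL y x; rewrite ler_distl => /andP[_].
  rewrite (_ : mdist y x = mdist x y); last exact: metric_sym.
  have := ler_wpM2l L0 (powR_tangent a0 (mdist_ge0 x y) p1).
  by rewrite /l; lra.
rewrite meanD ?mean_cst//; last exact: bounded_rv_cst.
have -> : l * rho = Lip * (a / p).
  have rhoE : rho = a `^ p by rewrite /a -powRrM mul1r mulVf// powRr1// ltW.
  have aE : a `^ (1 - p) * a `^ p = a.
    by rewrite -powRD ?(gt_eqF a0) ?implybT// subrK powRr1// ltW.
  by transitivity (Lip * (a `^ (1 - p) * a `^ p / p)); [rewrite rhoE /l; ring|rewrite aE].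
by rewrite -/a; lra.
Qed.

End duality.

(** * Uniform deviation bound *)

Section real_bounds.
Context {R : realType}.

Lemma sqrtr_add_le (a b : R) : 0 <= a -> 0 <= b ->
  Num.sqrt (a + b) <= Num.sqrt a + Num.sqrt b.
Proof.
move=> a0 b0; rewrite -(@ler_sqr _ (Num.sqrt _)) ?nnegrE ?addr_ge0 ?sqrtr_ge0//.
rewrite sqrrD !sqr_sqrtr ?addr_ge0//.
have := mulr_ge0 (sqrtr_ge0 a) (sqrtr_ge0 b); lra.
Qed.

Lemma sqrtr2_le : Num.sqrt 2 <= 3 / 2 :> R.
Proof.
rewrite -[leRHS]ger0_norm; last lra.
by rewrite -sqrtr_sqr ler_wsqrtr//; lra.
Qed.

Lemma ln2_le1 : ln 2 <= 1 :> R.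
Proof. by have := @le_ln1Dx R 1 _; rewrite (_ : 1 + 1 = 2)//; apply; lra. Qed.

Lemma sum_inv_exp2 (K : nat) : \sum_(i < K) (2 ^+ i)^-1 <= 2 :> R.
Proof.
suff -> : \sum_(i < K) (2 ^+ i)^-1 = 2 - 2 / 2 ^+ K :> R.
  by rewrite gerBl divr_ge0// exprn_ge0.
elim: K => [|K ih]; first by rewrite big_ord0 expr0 divr1 subrr.
by rewrite big_ord_recr/= ih exprS; field; rewrite expf_neq0// pnatr_eq0.
Qed.

Lemma sum_arith_inv_exp2 (K : nat) :
  \sum_(i < K) (3 * i%:R + 2) / 2 ^+ i <= 10 :> R.
Proof.
suff -> : \sum_(i < K) (3 * i%:R + 2) / 2 ^+ i = 10 - (6 * K%:R + 10) / 2 ^+ K :> R.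
  by rewrite gerBl divr_ge0// ?exprn_ge0// addr_ge0// mulr_ge0.
elim: K => [|K ih]; first by rewrite big_ord0 expr0 divr1; ring.
by rewrite big_ord_recr/= ih exprS -natr1; field; rewrite expf_neq0// pnatr_eq0.
Qed.

Lemma grid_approximation (M mu : R) (N : nat) : 0 < M -> (0 < N)%N ->
  0 <= mu <= M -> exists j : 'I_N, `|mu - j%:R * (M / N%:R)| <= M / N%:R.
Proof.
move=> M0 N0 /andP[mu0 muM].
have NR : 0 < N%:R :> R by rewrite ltr0n.
pose h := M / N%:R; have h0 : 0 < h by rewrite divr_gt0.
have /truncn_itv/andP[] : 0 <= mu / h by rewrite divr_ge0// ltW.
set t := Num.truncn _; rewrite ler_pdivlMr// ltr_pdivrMr// => th ht.
have [tN|Nt] := ltnP t N.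
  exists (Ordinal tN) => /=; rewrite -/h ger0_norm ?subr_ge0//.
  by rewrite lerBlDr ltW// (lt_le_trans ht)// -natr1 mulrDl mul1r addrC.
(* The grid stops one mesh short of [M], so [mu = M] is assigned to the last grid point. *)
have N1 : (N.-1 < N)%N by rewrite prednK.
exists (Ordinal N1) => /=; rewrite -/h.
have ME : M = N.-1%:R * h + h.
  by rewrite -[X in _ + X]mul1r -mulrDl natr1 prednK// /h mulrC divfK// gt_eqF.
have muE : mu = M.
  apply/eqP; rewrite eq_le muM/=; apply: le_trans th.
  have -> : M = N%:R * h by rewrite /h mulrC divfK// gt_eqF.
  by rewrite ler_wpM2r ?ler_nat// ltW.
by rewrite muE {1}ME addrAC subrr add0r ger0_norm// ltW.
Qed.

(** Subadditivity of the square root separates the confidence term, the grid and probability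
    factors, and the entropy. Against lengths [B * M / 2 ^+ i] these sum to at most 2 B M sqrt(2
    ln(2 / delta)), 15 B M and 12 M I, which the stated constant dominates. *)
Lemma chaining_sum_le (B M I delta : R) (n : nat) (m : nat -> nat) (K : nat) :
  0 < B -> 0 < M -> 0 < delta < 1 -> (0 < n)%N -> (forall k, (0 < m k)%N) ->
  \sum_(i < K) B / 2 ^+ i.+3 * Num.sqrt (ln (m i)%:R) <= I ->
  \sum_(i < K) B * M / 2 ^+ i *
     Num.sqrt (2 * ln ((m i * 4 ^ i.+1)%:R * (2 ^ i.+1)%:R / delta) / n%:R) <=
  (48 * (B + M) * (I + 2 * M) + 2 * B * M * Num.sqrt (2 * ln (2 / delta)))
    / Num.sqrt n%:R.
Proof.
move=> B0 M0 /andP[d0 d1] n0 m0 IK.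
have nR0 : 0 < n%:R :> R by rewrite ltr0n.
have sn0 : 0 < Num.sqrt n%:R :> R by rewrite sqrtr_gt0.
set L := Num.sqrt (2 * ln (2 / delta)).
have ln2d : 0 <= ln (2 / delta).
  by rewrite ln_ge0// ler_pdivlMr//; lra.
have term i : Num.sqrt (2 * ln ((m i * 4 ^ i.+1)%:R * (2 ^ i.+1)%:R / delta) / n%:R) <=
    (L + 3 / 2 * (3 * i%:R + 2) + 3 / 2 * Num.sqrt (ln (m i)%:R)) / Num.sqrt n%:R.
  have mi0 : 0 < (m i)%:R :> R by rewrite ltr0n.
  have lnm : 0 <= ln (m i)%:R :> R by rewrite ln_ge0// ler1n.
  (* One factor 2 is set aside to form [2 / delta]. *)
  have -> : (m i * 4 ^ i.+1)%:R * (2 ^ i.+1)%:R / delta =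
      (m i)%:R * 2 ^+ (3 * i + 2) * (2 / delta) :> R.
    have e42 : (4 ^ i.+1 * 2 ^ i.+1 = 2 ^ (3 * i + 2) * 2)%N.
      have -> : (4 ^ i.+1 = 2 ^ (2 * i.+1))%N by rewrite expnM.
      by rewrite -expnD -expnSr; congr expn; lia.
    by rewrite -natrM -mulnA e42 !natrM natrX; ring.
  have p20 : 0 < 2 ^+ (3 * i + 2) :> R by rewrite exprn_gt0.
  have d20 : 0 < 2 / delta by rewrite divr_gt0.
  rewrite lnM ?posrE//; last by rewrite mulr_gt0.
  rewrite lnM ?posrE// lnXn//.
  have ln20 : 0 <= ln 2 :> R by rewrite ln_ge0// ler1n.
  have il0 : 0 <= ln 2 *+ (3 * i + 2) :> R by rewrite mulrn_wge0.
  rewrite sqrtrM ?sqrtrV ?(ltW nR0)//; last by rewrite mulr_ge0// !addr_ge0.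
  rewrite ler_wpM2r ?invr_ge0 ?sqrtr_ge0// 2!mulrDr.
  apply: (le_trans (sqrtr_add_le _ _)); [by rewrite addr_ge0 ?mulr_ge0|by rewrite mulr_ge0|].
  rewrite -/L [leRHS]addrC [in leRHS]addrC -addrA [leLHS]addrC lerD2l [leRHS]addrC.
  apply: (le_trans (sqrtr_add_le _ _)); [by rewrite mulr_ge0|by rewrite mulr_ge0|].
  apply: lerD.
    by rewrite sqrtrM// ler_wpM2r ?sqrtr_ge0// sqrtr2_le.
  rewrite sqrtrM// ler_pM ?sqrtr_ge0 ?sqrtr2_le//.
  have r1 : 1 <= 3 * i%:R + 2 :> R by have := ler0n R i; lra.
  have le1 : ln 2 *+ (3 * i + 2) <= 3 * i%:R + 2 :> R.
    by rewrite -[ln 2 *+ _]mulr_natl natrD natrM ler_piMr ?ln2_le1// (le_trans _ r1).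
  (* A number at least 1 is at most its square, which removes the root at the price of a larger
     constant. *)
  apply: (@le_trans _ _ (Num.sqrt ((3 * i%:R + 2) ^+ 2))).
    by rewrite ler_wsqrtr// (le_trans le1)// expr2 ler_peMl// (le_trans _ r1).
  by rewrite sqrtr_sqr ger0_norm// (le_trans _ r1).
have BM0 : 0 <= B * M by rewrite mulr_ge0 ?ltW.
apply: (@le_trans _ _ (\sum_(i < K) (B * M * L * (2 ^+ i)^-1 +
    B * M * (3 / 2) * ((3 * i%:R + 2) / 2 ^+ i) +
    12 * M * (B / 2 ^+ i.+3 * Num.sqrt (ln (m i)%:R))) / Num.sqrt n%:R)).
  apply: ler_sum => i _.
  have e0 : 0 < (2 ^+ i)^-1 :> R by rewrite invr_gt0 exprn_gt0.
  have := ler_wpM2l (mulr_ge0 BM0 (ltW e0)) (term i) => /le_trans; apply.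
  rewrite le_eqVlt; apply/orP; left; apply/eqP.
  rewrite !exprS; field.
  by rewrite expf_neq0 ?pnatr_eq0// gt_eqF.
rewrite -mulr_suml ler_pM2r ?invr_gt0//.
rewrite !big_split/= -!mulr_sumr.
have BML0 : 0 <= B * M * L by rewrite mulr_ge0// sqrtr_ge0.
have h1 := ler_wpM2l BML0 (sum_inv_exp2 K).
have BM32 : 0 <= B * M * (3 / 2) by rewrite mulr_ge0//; lra.
have h2 := ler_wpM2l BM32 (sum_arith_inv_exp2 K).
have M12 : 0 <= 12 * M by rewrite mulr_ge0// ltW.
have h3 := ler_wpM2l M12 IK.
have I0 : 0 <= I.
  apply: le_trans IK; apply: sumr_ge0 => i _.
  by rewrite mulr_ge0 ?sqrtr_ge0// divr_ge0 ?exprn_ge0 ?ltW.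
have BI : 0 <= B * I by rewrite mulr_ge0// ltW.
have MI : 0 <= M * I by rewrite mulr_ge0// ltW.
have MM : 0 <= M * M by rewrite mulr_ge0// ltW.
nra.
Qed.

End real_bounds.

Section sup_norm_theory.
Context {R : realType} {T : pointedType}.

Lemma sup_norm_ge (g : T -> R) K x : (forall y, `|g y| <= K) -> `|g x| <= sup_norm g.
Proof.
move=> gK; apply: ub_le_sup; last by exists x.
by exists K => _ [y _ <-].
Qed.

Lemma sup_norm_le (g : T -> R) K : (forall y, `|g y| <= K) -> sup_norm g <= K.
Proof.
move=> gK; apply: ge_sup; first by exists `|g point|; exists point.
by move=> _ [y _ <-].
Qed.

(** Finite entropy gives a finite net at scale 1 with bounded centres. *)
Lemma dudley_bounded (F : set (T -> R)) : (dudley F < +oo)%E ->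
  (forall f, F f -> exists K, forall x, `|f x| <= K) ->
  exists K, forall f, F f -> forall x, `|f x| <= K.
Proof.
move=> Ffin Fb.
have [[f0 Ff0]|F0] := pselect (exists f, F f); last first.
  by exists 0 => f Ff; exfalso; apply: F0; exists f.
have [m [p [[pF _] pcov]]] := maximal_packing (packing_number_lty Ffin Ff0 ltr01).
have [K pK] : exists K : 'I_m -> R, forall i x, `|p i x| <= K i.
  by exists (fun i => projT1 (cid (Fb _ (pF i)))) => i; case: cid.
exists (\sum_i `|K i| + 1) => f Ff x.
have [i fpi] := pcov f Ff.
have [Kf fK] := Fb f Ff.
have fpK y : `|f y - p i y| <= Kf + K i by rewrite (le_trans (ler_normB _ _))// lerD.
rewrite -[f x](subrK (p i x)) (le_trans (ler_normD _ _))// addrC lerD//.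
  rewrite (le_trans (pK i x))// (le_trans (ler_norm _))// (bigD1 i)//= lerDl.
  by apply: sumr_ge0.
by rewrite (le_trans (sup_norm_ge x fpK))// ltW.
Qed.

Lemma family_norm_ge (F : set (T -> R)) K f x :
  (forall f, F f -> forall x, `|f x| <= K) -> F f -> `|f x| <= family_norm F.
Proof.
move=> FK Ff; apply: le_trans (sup_norm_ge x (FK _ Ff)) _.
apply: ub_le_sup; last by exists f.
by exists K => _ [g Fg <-]; apply: sup_norm_le; exact: FK.
Qed.

End sup_norm_theory.

Section uniform_deviation.
Context {R : realType} {Xi : pmetricType R}.
Variable c : Xi -> Xi -> R.
Hypothesis c_ge0 : forall x y, 0 <= c x y.
Hypothesis c_diag : forall x, c x x = 0.
Hypothesis Xi_compact : compact [set: Xi].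
Hypothesis c_cont : continuous (fun z : Xi * Xi => c z.1 z.2).
Variable F : set (Xi -> R).
Hypothesis F_dudley : (dudley F < +oo)%E.
Variables (B M delta : R).
Hypothesis B_gt0 : 0 < B.
Hypothesis F_le : forall f, F f -> forall x, `|f x| <= B.
Hypothesis M_gt0 : 0 < M.
Hypothesis delta01 : 0 < delta < 1.

(* Bounds the deviations of [sup_zeta (mu f(zeta) - c(., zeta))], that is, of
   [mu * phi (1 / mu, f)], for all [mu <= M] at once. *)
Lemma uniform_deviation {d} {Omega : measurableType d} (Pr : probability Omega R)
    (P : probability (borel Xi) R) (n : nat) (X : 'I_n -> Omega -> borel Xi) :
  iid_from Pr P X -> (0 < n)%N ->
  exists E, [/\ measurable E, ((1 - delta)%:E <= Pr E)%E &
    forall w, E w -> forall f, F f -> forall mu, 0 <= mu <= M ->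
      deviation P X (dual_generator c 1 (fun x => mu * f x)) w <=
      (48 * (B + M) * (fine (dudley F) + 2 * M) +
        2 * B * M * Num.sqrt (2 * ln (2 / delta))) / Num.sqrt n%:R].
Proof.
move=> X_iid n0.
have [[f0 Ff0]|F0] := pselect (exists f, F f); last first.
  exists setT; split=> //; last by move=> w _ f Ff; exfalso; apply: F0; exists f.
  by rewrite [Pr _]probability_setT lee_fin gerBl ltW//; case/andP: delta01.
pose s k : R := B / 2 ^+ k.+1.
have s_gt0 k : 0 < s k by rewrite divr_gt0// exprn_gt0.
have s_dec k : s k.+1 <= s k.
  rewrite ler_pM2l// lef_pV2 ?posrE ?exprn_gt0//.
  by rewrite [in leRHS]exprS ler_peMl ?exprn_ge0// ler1n.
have ex k := cid (maximal_packing (packing_number_lty F_dudley Ff0 (s_gt0 k))).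
pose m k := projT1 (ex k).
pose p k : 'I_(m k) -> Xi -> R := projT1 (cid (projT2 (ex k))).
have pp k : is_packing F (s k) (p k) by case: (projT2 (cid (projT2 (ex k)))).
have pcov k f : F f -> exists i, sup_norm (fun x => f x - p k i x) < s k.
  by case: (projT2 (cid (projT2 (ex k)))) => _; exact.
have m_gt0 k : (0 < m k)%N.
  by have [i _] := pcov k _ Ff0; exact: leq_ltn_trans (ltn_ord i).
(* Level 0 has the one-point grid {0}, so its functions vanish as [chaining] requires. *)
pose J k : finType := ('I_(m k) * 'I_(4 ^ k))%type.
pose mu k (j : J k) : R := j.2%:R * (M / (4 ^ k)%:R).
pose h k (j : J k) x : R := mu k j * p k j.1 x.
pose q k (j : J k) : borel Xi -> R := dual_generator c 1 (h k j).
pose l k : R := B * M / 2 ^+ k.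
have pF k i : F (p k i) by case: (pp k).
have mu01 k j : 0 <= mu k j <= M.
  have N0 : 0 < (4 ^ k)%:R :> R by rewrite ltr0n expn_gt0.
  apply/andP; split; first by rewrite mulr_ge0// divr_ge0// ltW.
  by rewrite /mu mulrA ler_pdivrMr// mulrC ler_pM2l// ler_nat ltnW.
have l_gt0 k : 0 < l k by rewrite divr_gt0 ?mulr_gt0// exprn_gt0.
have muf_le f mu' x : F f -> 0 <= mu' <= M -> `|mu' * f x| <= B * M.
  move=> Ff /andP[mu0 muM]; rewrite normrM (ger0_norm mu0) mulrC.
  by rewrite ler_pM// F_le.
(* The error splits into [M] times the packing scale and [B] times the mesh; 4^(k+1) >= 2^(k+2)
   makes each at most half of [l k.+1]. *)
have cover k f mu' : F f -> 0 <= mu' <= M ->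
    exists j : J k, forall x, `|mu' * f x - h k j x| <= l k.
  move=> Ff mu'M; case: k => [|k].
    have i0 : 'I_(m 0%N) by exact: Ordinal (m_gt0 0%N).
    exists (i0, ord0) => x; rewrite /h /mu/= mul0r mul0r subr0 /l expr0 divr1.
    exact: muf_le.
  have [i fpi] := pcov k.+1 f Ff.
  have [j muj] := grid_approximation M_gt0 (expn_gt0 4 k.+1) mu'M.
  exists (i, j) => x; rewrite /h /mu/=; set nu := j%:R * _.
  have -> : mu' * f x - nu * p k.+1 i x =
      mu' * (f x - p k.+1 i x) + (mu' - nu) * p k.+1 i x.
    by ring.
  rewrite (le_trans (ler_normD _ _))// !normrM.
  have /andP[mu0 muM] := mu'M.
  have fpx : `|f x - p k.+1 i x| <= s k.+1.
    apply: le_trans (ltW fpi).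
    apply: (@sup_norm_ge R Xi (fun x => f x - p k.+1 i x) (B + B) x) => y.
    by rewrite (le_trans (ler_normB _ _))// lerD// F_le.
  apply: (@le_trans _ _ (M * s k.+1 + M / (4 ^ k.+1)%:R * B)).
    by apply: lerD; apply: ler_pM => //; [rewrite ger0_norm|exact: F_le].
  have k4 : (2 : R) ^+ k.+2 <= (4 ^ k.+1)%:R.
    rewrite -natrX ler_nat (_ : 4 ^ k.+1 = 2 ^ (2 * k.+1))%N; last by rewrite expnM.
    by rewrite leq_exp2l//; lia.
  have i4 : (4 ^ k.+1)%:R^-1 <= (2 ^+ k.+2)^-1 :> R.
    by rewrite lef_pV2 ?posrE ?exprn_gt0// ltr0n expn_gt0.
  have -> : l k.+1 = M * s k.+1 + M * (2 ^+ k.+2)^-1 * B.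
    by rewrite /l /s !exprS; field; rewrite expf_neq0// pnatr_eq0.
  by rewrite lerD2l ler_pM2r// ler_pM2l.
(* A net function of level [k.+1] is itself a scaled member of [F], so level [k] covers it and a
   link costs one covering radius. *)
have par_ex k (j : J k.+1) : exists j' : J k, forall x, `|h k.+1 j x - h k j' x| <= l k.
  by apply: cover.
pose par k j := projT1 (cid (par_ex k j)).
have h_le k j x : `|h k j x| <= B * M by exact: muf_le.
have q_rv k j : bounded_rv (q k j).
  by apply: dual_bounded_rv => //; exact: h_le.
have q0 j x : q 0%N j x = 0.
  apply/eqP; rewrite -normr_le0; apply: dual_norm_le => // y.
  by rewrite /h /mu; case: j => i [[]//= ?]; rewrite !mul0r normr0.
have qpar k j x : `|q k.+1 j x - q k (par k j) x| <= l k.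
  apply: dual_lipschitz => //.
  exact: (projT2 (cid (par_ex k j))).
have d01 : 0 < delta <= 1 by case/andP: delta01 => -> /ltW ->.
have [E [mE PE Edev]] := chaining X_iid n0 d01 q_rv q0 l_gt0 qpar.
exists E; split=> // w Ew f Ff mu' mu'M.
set bound := (X in _ <= X).
have level k j : deviation P X (q k j) w <= bound.
  apply: le_trans (Edev w Ew k j) _.
  under eq_bigr do rewrite card_prod !card_ord.
  apply: (chaining_sum_le (m := fun i => m i.+1)) => //.
  apply: le_trans (packing_sum_le_dudley (s := fun k => s k.+1)
    (p := fun k => p k.+1) k F_dudley Ff0 _ _ _ _) => //.
  rewrite le_eqVlt; apply/orP; left; apply/eqP; apply: eq_bigr => i _; congr (_ * _).
  by rewrite /s !exprS; field; rewrite expf_neq0// pnatr_eq0.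
(* The bound is the same at every level. Passing from a net function to an arbitrary one changes the
   deviation by at most [l k + l k], which tends to 0. *)
apply/ler_addgt0Pr => e e0.
have [k lk] : exists k, l k + l k <= e.
  pose k := (Num.truncn ((B * M + B * M) / e)).+1; exists k.
  have kE : (B * M + B * M) / e < k%:R by exact: truncnS_gt.
  have k2 : k%:R <= 2 ^+ k :> R by rewrite -natrX ler_nat ltnW// ltn_expl.
  rewrite /l -mulrDl ler_pdivrMr ?exprn_gt0// -ler_pdivrMl// mulrC.
  by rewrite (le_trans (ltW kE)).
have [j fj] := cover k f mu' Ff mu'M.
have bg : bounded_rv (dual_generator c 1 (fun x => mu' * f x) : borel Xi -> R).
  by apply: dual_bounded_rv => // y; exact: muf_le.
have bgq := bounded_rvB bg (q_rv k j).
have := deviation_le P X w n0 bgq (e := l k) => /(_ _).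
have gq x : `|dual_generator c 1 (fun x => mu' * f x) x - q k j x| <= l k.
  by apply: dual_lipschitz => // y; exact: muf_le.
move=> /(_ gq); rewrite deviationB//; have := level k j; lra.
Qed.

End uniform_deviation.

(** * Critical and maximal radii *)

(* The integral of a nonnegative function is the supremum of the integrals of
   the simple functions below it. *)
Lemma ge0_le_integralT (R : realType) d (T : measurableType d)
    (mu : {measure set T -> \bar R}) (f g : T -> \bar R) :
  (forall x, 0 <= f x)%E -> (forall x, f x <= g x)%E ->
  (\int[mu]_x f x <= \int[mu]_x g x)%E.
Proof.
move=> f0 fg; rewrite !ge0_integralTE//; last by move=> x; exact: le_trans (fg x).
by apply: le_ereal_sup => _ [h hf <-]; exists h => // x; exact: le_trans (fg x).
Qed.

Section empirical_coupling.
Context {R : realType} {d d' : measure_display}.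
Context {T : measurableType d} {S : measurableType d'}.

(** The marginal agrees with [empirical] on measurable sets, hence with a scaled sum of Dirac
    masses; nonnegative functions come first, then a shift by [M]. *)
Lemma mean_empirical (n : nat) (x : 'I_n -> T) (pi : probability S R)
    (X : S -> T) (g : T -> R) : (0 < n)%N -> measurable_fun setT X ->
  (forall A, measurable A -> pushforward pi X A = empirical x A) ->
  bounded_rv g -> mean pi (g \o X) = n%:R^-1 * \sum_(i < n) g (x i).
Proof.
move=> n0 mX XE bg.
have nR0 : 0 < n%:R :> R by rewrite ltr0n.
have ge0E h : bounded_rv h -> (forall y, 0 <= h y) ->
    mean pi (h \o X) = n%:R^-1 * \sum_(i < n) h (x i).
  move=> bh h0; have mh : measurable_fun setT (EFin \o h) by apply/measurable_EFinP; case: bh.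
  apply: EFin_inj; rewrite -meanE; last exact: bounded_rv_comp.
  have n0' : 0 <= n%:R^-1 :> R by rewrite invr_ge0 ltW.
  pose m (k : nat) : {measure set T -> \bar R} :=
    if insub k is Some i then \d_(x i) else mzero.
  transitivity (\int[mscale (NngNum n0') (msum m n)]_y (h y)%:E)%E.
    transitivity (\int[pushforward pi X]_y (h y)%:E)%E.
      apply/esym; apply: ge0_integral_pushforward => // y _.
      by rewrite lee_fin.
    apply: eq_measure_integral => A mA _.
    transitivity (empirical (R := R) x A); first exact: XE.
    rewrite /empirical /mscale /msum /=; congr *%E.
    by apply: eq_bigr => i _; rewrite /m valK.
  have h0' y : setT y -> (0 <= (EFin \o h) y)%E by rewrite /= lee_fin.
  rewrite ge0_integral_mscale// ge0_integral_measure_sum//= EFinM; congr *%E.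
  rewrite -sumEFin; apply: eq_bigr => i _.
  by rewrite /m valK integral_dirac// diracT mul1e.
have [_ [M gM]] := bg.
have bM : bounded_rv (cst M : T -> R) by exact: bounded_rv_cst.
have := ge0E _ (bounded_rvD bg bM).
have -> : (fun y => g y + cst M y) \o X = (fun s => (g \o X) s + M) by [].
rewrite meanD; [|exact: bounded_rv_comp|exact: bounded_rv_cst].
rewrite mean_cst big_split/= sumr_const card_ord mulrDr -[M *+ n]mulr_natl.
rewrite mulrA mulVf ?gt_eqF// mul1r => H; apply: (addIr M); apply: H => y.
by have := gM y; rewrite ler_norml => /andP[]; lra.
Qed.

End empirical_coupling.

Section right_derivative_bounds.
Context {R : realType}.

(* The second hypothesis is convexity, as the three-chord inequality. *)
Lemma right_derivative_bounds (g : R -> R) (x : R) : 0 < x ->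
  (forall a b d, 0 <= a -> a < b -> b < d ->
     (d - a) * g b <= (d - b) * g a + (b - a) * g d) ->
  (forall a b, 0 <= a -> a <= b -> g b <= g a) ->
  right_derivative g x <= 0 /\
  forall y, 0 <= y -> y < x -> g x - g y <= right_derivative g x * (x - y).
Proof.
move=> x0 gconv gni.
pose s h := h^-1 * (g (x + h) - g x).
have s_le0 h : 0 < h -> s h <= 0.
  move=> h0; rewrite /s pmulr_rle0 ?invr_gt0// subr_le0.
  by apply: gni; [exact: ltW|rewrite lerDl ltW].
have s_ge y h : 0 <= y -> y < x -> 0 < h -> (g x - g y) / (x - y) <= s h.
  move=> y0 yx h0; have xy : 0 < x - y by rewrite subr_gt0.
  rewrite ler_pdivrMr// /s mulrAC -mulrA ler_pdivlMl//.
  have xh : x < x + h by rewrite ltrDl.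
  have := gconv y x (x + h) y0 yx xh; lra.
have s_nd h k : 0 < h -> h < k -> s h <= s k.
  move=> h0 hk; have k0 := lt_trans h0 hk.
  rewrite /s [leRHS]mulrC ler_pdivlMr// mulrAC -mulrA ler_pdivrMl//.
  have xh : x < x + h by rewrite ltrDl.
  have hk' : x + h < x + k by rewrite ltrD2l.
  have := gconv x (x + h) (x + k) (ltW x0) xh hk'; lra.
(* The quotients are monotone in [h] and bounded below by the chord from 0, so the [lim] in
   [right_derivative] is a genuine limit. *)
have cvs : cvg (s h @[h --> 0^'+]).
  apply: nondecreasing_at_right_is_cvgr; apply: nearW => k.
    move=> a b; rewrite !in_itv/= => /andP[a0 _] /andP[b0 _].
    by rewrite le_eqVlt => /predU1P[->//|]; exact: s_nd.
  exists ((g x - g 0) / (x - 0)) => _ [h hk <-].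
  move: hk; rewrite /= in_itv/= => /andP[h0 _].
  exact: s_ge.
split.
  by apply: limr_le => //; near=> h; apply: s_le0.
move=> y y0 yx; have xy : 0 < x - y by rewrite subr_gt0.
rewrite -ler_pdivrMr//; apply: limr_ge => //.
by near=> h; apply: s_ge.
Unshelve. all: by end_near. Qed.

End right_derivative_bounds.

Section radii.
Context {R : realType} {Xi : pmetricType R}.
Variable c : Xi -> Xi -> R.
Hypothesis c_ge0 : forall x y, 0 <= c x y.
Hypothesis c_diag : forall x, c x x = 0.
Variable F : set (Xi -> R).
Variable P : probability (borel Xi) R.

(** Every point maximises a constant function, so its cost to the argmax is [c x x]. Used in
    contrapositive form to exclude degenerate families. *)
Lemma rho_crit_le0 : (forall f, F f -> forall x y, f x = f y) -> rho_crit c P F <= 0.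
Proof.
move=> Fcst; rewrite /rho_crit; set S := (X in inf X).
have S0 : S `<=` [set 0].
  move=> _ [f Ff <-]; rewrite [X in fine X](_ : _ = 0%E)//.
  rewrite [X in ('E_P[X])%E](_ : _ = cst 0); first by rewrite expectation_cst.
  apply/funext => x; apply/eqP; rewrite eq_le; apply/andP; split.
    apply: ge_inf; first by exists 0 => _ [y _ <-].
    by exists x => // y; rewrite (Fcst _ Ff y x).
  apply: lb_le_inf; last by move=> _ [y _ <-].
  by exists (c x x); exists x => // y; rewrite (Fcst _ Ff y x).
(* An empty [F] gives the infimum of the empty set, which is 0 by convention. *)
by have [->|->] := subset_set1 S0; rewrite ?inf0 ?inf1.
Qed.

Hypothesis Xi_compact : compact [set: Xi].
Hypothesis c_cont : continuous (fun z : Xi * Xi => c z.1 z.2).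
Hypothesis F_cont : forall f, F f -> continuous f.

(** By convexity the right derivative at [l] bounds every chord slope to its left; integrate over
    [P] and take the infimum over [F]. *)
Lemma rho_max_slope (f : Xi -> R) (l l1 : R) : F f -> 0 <= l1 -> l1 < l ->
  rho_max c P F l * (l - l1) <=
  mean P (dual_generator c l1 f) - mean P (dual_generator c l f).
Proof.
move=> Ff l10 l1l; have l0 := le_lt_trans l10 l1l.
have D f' : F f' -> forall x,
    right_derivative (fun l => dual_generator c l f' x) l <= 0 /\
    forall y, 0 <= y -> y < l -> dual_generator c l f' x - dual_generator c y f' x <=
      right_derivative (fun l => dual_generator c l f' x) l * (l - y).
  move=> /F_cont cf x; have [M fM] := continuous_bounded Xi_compact cf.
  apply: right_derivative_bounds => // [a b d a0 ab bd|a b a0 ab].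
    exact: (dual_convex c_ge0 _ a0 ab bd fM).
  exact: (dual_nonincreasing c_ge0 _ a0 ab fM).
have ll1 : 0 < l - l1 by rewrite subr_gt0.
have [M fM] := continuous_bounded Xi_compact (F_cont Ff).
have b1 : bounded_rv (dual_generator c l1 f : borel Xi -> R) by exact: dual_bounded_rv fM.
have b2 : bounded_rv (dual_generator c l f : borel Xi -> R).
  by apply: dual_bounded_rv fM => //; exact: ltW.
rewrite -ler_pdivlMr// mulrC -meanB// -meanZ; last exact: bounded_rvB.
have bs : bounded_rv ((fun x => (l - l1)^-1 *
    (dual_generator c l1 f x - dual_generator c l f x)) : borel Xi -> R).
  by apply: bounded_rvZ; exact: bounded_rvB.
pose e f' := ('E_P[fun xi =>
  (- right_derivative (fun l => dual_generator c l f' xi) l)%R])%E.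
have e0 f' : F f' -> (0 <= e f')%E.
  by move=> Ff'; apply: expectation_ge0 => x; rewrite oppr_ge0; have [] := D _ Ff' x.
apply: (@le_trans _ _ (fine (e f))).
  apply: ge_inf; last by exists f.
  by exists 0 => _ [f' Ff' <-]; apply: fine_ge0; exact: e0.
(* The integrals are compared without measurability of the right derivative. The finite bound also
   ensures that [fine] loses nothing. *)
have le : (e f <= (mean P (fun x => (l - l1)^-1 *
    (dual_generator c l1 f x - dual_generator c l f x)))%:E)%E.
  rewrite -meanE// /e unlock; apply: ge0_le_integralT => x; rewrite lee_fin.
    by rewrite oppr_ge0; have [] := D _ Ff x.
  rewrite ler_pdivlMl//; have [_ /(_ _ l10 l1l)] := D _ Ff x; lra.
by rewrite -lee_fin fineK// ge0_fin_numE ?e0// (le_lt_trans le)// ltry.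
Qed.

End radii.

(** * From duality and deviations to the robust risk *)

Lemma empirical_robust_risk_le (R : realType) (Xi : pmetricType R)
    (c : Xi -> Xi -> R) (f : Xi -> R) (n : nat) (x : 'I_n -> borel Xi) (rho l : R) :
  (forall x y, 0 <= c x y) -> (forall x, c x x = 0) -> compact [set: Xi] ->
  continuous (fun z : Xi * Xi => c z.1 z.2) -> continuous f -> (0 < n)%N -> 0 <= l ->
  (robust_risk c rho (empirical x) f <=
   (l * rho + n%:R^-1 * \sum_(i < n) dual_generator c l f (x i))%:E)%E.
Proof.
move=> c_ge0 c_diag Xi_compact c_cont cf n0 l0.
have [M fM] := continuous_bounded Xi_compact cf.
apply: weak_duality => // Q' pi cpi.
apply: (mean_empirical n0 borel_fst) => [A mA|].
  by have [] := cpi A mA.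
exact: dual_bounded_rv fM.
Qed.

Theorem proposition3p1
  (R : realType) (Xi : pmetricType R)
  (c : Xi -> Xi -> R) (F : set (Xi -> R))
  (Xi_compact : compact [set: Xi])
  (c_cont : continuous (fun z : Xi * Xi => c z.1 z.2))
  (c_ge0 : forall xi zeta, 0 <= c xi zeta)
  (c_eq0 : forall xi zeta, c xi zeta = 0 <-> xi = zeta)
  (F_cont : forall f, F f -> continuous f)
  (F_compact : compact (F : set {uniform Xi -> R}))
  (F_dudley : (dudley F < +oo)%E)
  (P : probability (borel Xi) R)
  (rho_crit_gt0 : 0 < rho_crit c P F)
  (lambda_low : R) (lambda_low_gt0 : 0 < lambda_low)
  (lambda_lowP : forall lambda, 0 <= lambda <= 2 * lambda_low ->
     rho_crit c P F / 4 <= rho_max c P F lambda)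
  (delta : R) (delta01 : 0 < delta < 1)
  (alpha : R)
  (alphaE : alpha =
     48 * (family_norm F + 1 / lambda_low)
        * (fine (dudley F) + 2 / lambda_low)
     + 2 * family_norm F / lambda_low * Num.sqrt (2 * ln (2 / delta)))
  (n : nat) (n_large : 16 * alpha ^+ 2 / rho_crit c P F ^+ 2 < n%:R)
  (rho : R) (rho_gt0 : 0 < rho)
  (rho_le : rho <= rho_crit c P F / 4 - alpha / Num.sqrt n%:R)
  (dO : measure_display) (Omega : measurableType dO)
  (Pr : probability Omega R)
  (X : 'I_n -> Omega -> borel Xi) (X_iid : iid_from Pr P X) :
  with_probability_at_least Pr (1 - delta)
    [set w | forall f, F f ->
       (robust_risk c rho (empirical (fun i => X i w)) f
        <= robust_risk c (rho + alpha / Num.sqrt n%:R) P f)%E]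
  /\
  (forall (p : R) (Lip : R), 1 <= p ->
     (forall xi zeta, c xi zeta = mdist xi zeta `^ p) ->
     (forall f, F f ->
        forall xi zeta, `|f xi - f zeta| <= Lip * mdist xi zeta) ->
     with_probability_at_least Pr (1 - delta)
       [set w | forall f, F f ->
          (robust_risk c rho (empirical (fun i => X i w)) f
           <= 'E_P[f]
              + (Lip * (rho + alpha / Num.sqrt n%:R) `^ (1 / p))%:E)%E]).
Proof.
have c_diag x : c x x = 0 by apply/c_eq0.
have n0 : (0 < n)%N.
  rewrite -(ltr0n R); apply: le_lt_trans n_large.
  by rewrite divr_ge0 ?sqr_ge0// mulr_ge0// sqr_ge0.
have [K FK] : exists K, forall f, F f -> forall x, `|f x| <= K.
  apply: dudley_bounded F_dudley _ => f Ff.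
  exact: (continuous_bounded Xi_compact (F_cont f Ff)).
pose B := family_norm F.
have F_le f : F f -> forall x, `|f x| <= B.
  by move=> Ff x; exact: family_norm_ge FK Ff.
(* Otherwise every member of [F] is the zero function, contradicting the positive critical
   radius. *)
have B_gt0 : 0 < B.
  rewrite ltNge; apply/negP => B0; move: rho_crit_gt0; apply/negP; rewrite -leNgt.
  apply: rho_crit_le0 => // f Ff x y.
  by have := F_le f Ff x; have := F_le f Ff y; rewrite !ler_norml; lra.
pose M := lambda_low^-1.
have M_gt0 : 0 < M by rewrite invr_gt0.
have D0 : 0 <= fine (dudley F).
  by apply/fine_ge0/integral_ge0 => t _; exact: poweR_ge0.
have alphaE' : alpha = 48 * (B + M) * (fine (dudley F) + 2 * M) +
    2 * B * M * Num.sqrt (2 * ln (2 / delta)).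
  by rewrite alphaE mul1r.
have alpha_ge0 : 0 <= alpha.
  rewrite alphaE' addr_ge0// ?mulr_ge0 ?sqrtr_ge0 ?addr_ge0 ?mulr_ge0//; exact: ltW.
pose a := alpha / Num.sqrt n%:R.
have a_ge0 : 0 <= a by rewrite divr_ge0// sqrtr_ge0.
have [E [mE PE Edev]] :=
  uniform_deviation c_ge0 c_diag Xi_compact c_cont F_dudley B_gt0 F_le M_gt0 delta01 X_iid n0.
rewrite -alphaE' -/a in Edev.
have main w f : E w -> F f ->
    (robust_risk c rho (empirical (fun i => X i w)) f <= robust_risk c (rho + a) P f)%E.
  move=> Ew Ff; have cf := F_cont f Ff.
  have rhoa : 0 < rho + a by rewrite ltr_pwDl.
  have [l l0] := strong_duality c_ge0 c_diag Xi_compact c_cont P cf rhoa.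
  apply: le_trans.
  (* Raising a small multiplier to [lambda_low] does not increase the dual objective, because
     [rho + a] is at most the maximal radius there. *)
  have [l' ll' lP] : exists2 l', lambda_low <= l' &
      l' * (rho + a) + mean P (dual_generator c l' f) <=
      l * (rho + a) + mean P (dual_generator c l f).
    have [ll|ll] := leP lambda_low l; first by exists l.
    exists lambda_low => //.
    have slope := rho_max_slope c_ge0 c_diag P Xi_compact c_cont F_cont Ff l0 ll.
    have llow : 0 <= lambda_low <= 2 * lambda_low by lra.
    have ra : rho + a <= rho_max c P F lambda_low.
      by apply: le_trans (lambda_lowP _ llow); rewrite -lerBrDr.
    have ll0 : 0 <= lambda_low - l by rewrite subr_ge0 ltW.
    have := ler_wpM2r ll0 ra; lra.
  have l'0 : 0 < l' by exact: lt_le_trans ll'.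
  apply: le_trans (empirical_robust_risk_le (fun i => X i w) rho c_ge0 c_diag
    Xi_compact c_cont cf n0 (ltW l'0)) _.
  rewrite lee_fin; apply: le_trans lP.
  have mu01 : 0 <= l'^-1 <= M.
    by rewrite invr_ge0 ltW//= lef_pV2 ?posrE.
  have := Edev w Ew f Ff _ mu01.
  have l'V0 : 0 < l'^-1 by rewrite invr_gt0.
  have -> : dual_generator c 1 (fun x => l'^-1 * f x) =
      (fun x => l'^-1 * dual_generator c l' f x).
    by apply/funext => x; rewrite (dual_scale c_ge0 _ l'V0 (F_le f Ff)) invrK.
  rewrite /deviation meanZ; last first.
    exact: (dual_bounded_rv c_ge0 c_diag Xi_compact c_cont (ltW l'0) (F_le f Ff)).
  (* Multiplying by [l'] bounds the deviation of phi by [l' * a], exactly the gap between [l' * rho]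
     and [l' * (rho + a)]. *)
  rewrite -mulr_sumr mulrCA -mulrBr mulrC ler_pdivrMr//.
  lra.
split; first by exists E; split=> // w Ew f; exact: main.
move=> p Lip p1 cE fL; exists E; split=> // w Ew f Ff.
apply: le_trans (main w f Ew Ff) _.
(* A negative constant would make every member of [F] constant, again contradicting the positive
   critical radius. *)
have L0 : 0 <= Lip.
  rewrite leNgt; apply/negP => L0; move: rho_crit_gt0; apply/negP; rewrite -leNgt.
  apply: rho_crit_le0 => // g Fg x y.
  have := fL g Fg x y; have := mdist_ge0 x y; have := normr_ge0 (g x - g y) => h1 h2 h3.
  have : `|g x - g y| <= 0 by nra.
  by rewrite normr_le0 subr_eq0 => /eqP.
by apply: robust_risk_lipschitz_le => //; [exact: F_cont|rewrite ltr_pwDl|exact: fL].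
Qed.
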